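(* Let $f\in\Gamma_0(\mathcal{X})$, $g\in\Gamma_0(\mathcal{K})$ and $A\in\mathcal{B}(\mathcal{X},\mathcal{K})$ satisfy $\mathcal{S}_p:=\operatorname{argmin}_{x\in\mathcal{X}}[f(x)+g(Ax)]\neq\varnothing$ and the qualification condition $0\in\operatorname{sri}(\operatorname{dom}(g)-A\operatorname{dom}(f))$, and let $\mathfrak{u}>0$ be such that $\|\check{A}\|_{\rm op}\le\frac{1}{\mathfrak{u}}$, where $\check{A}:\mathcal{X}\times\mathcal{K}\to\mathcal{K}:(x,y)\mapsto Ax-y$. Suppose also that $\Psi\in\Gamma_0(\mathcal{X})$ is Gâteaux differentiable and that its gradient $\nabla\Psi$ is Lipschitzian and strongly monotone over $\mathcal{X}$. Define $\mathbf{T}_{\rm LAL}:\mathcal{X}\times\mathcal{K}\times\mathcal{K}\to\mathcal{X}\times\mathcal{K}\times\mathcal{K}:(x,y,\nu)\mapsto(x_T,y_T,\nu_T)$ by $$\begin{aligned}x_T&=\operatorname{prox}_f\bigl(x-\mathfrak{u}^2(A^*Ax-A^*y)+\mathfrak{u}A^*\nu\bigr),\\ y_T&=\operatorname{prox}_g\bigl(y-\mathfrak{u}^2(-Ax+y)-\mathfrak{u}\nu\bigr),\\ \nu_T&=\nu-\mathfrak{u}(Ax_T-y_T).\end{aligned}$$ Then $\mathbf{T}_{\rm LAL}$ can be plugged into the hybrid steepest descent method, with any $\alpha\in(0,1]$ and any $\eta_{xy},\eta_\nu>0$, as $$\begin{aligned}(x_{n+1/2},y_{n+1/2},\nu_{n+1/2})&=(1-\alpha)(x_n,y_n,\nu_n)+\alpha\mathbf{T}_{\rm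 LAL}(x_n,y_n,\nu_n),\\ x_{n+1}&=x_{n+1/2}-\lambda_{n+1}\bigl(\nabla\Psi(x_{n+1/2})+\eta_{xy}A^*(Ax_{n+1/2}-y_{n+1/2})\bigr),\\ y_{n+1}&=y_{n+1/2}+\lambda_{n+1}\eta_{xy}(Ax_{n+1/2}-y_{n+1/2}),\\ \nu_{n+1}&=\nu_{n+1/2}-\lambda_{n+1}\eta_\nu\nu_{n+1/2},\end{aligned}$$ and, for any $(x_0,y_0,\nu_0)\in\mathcal{X}\times\mathcal{K}\times\mathcal{K}$, this algorithm generates a sequence $(x_n)_{n\in\mathbb{N}}\subset\mathcal{X}$ which converges strongly to the uniquely existing solution of the problem $$\text{minimize }\Psi(x^\star)\ \text{ subject to }\ x^\star\in\mathcal{S}_p,$$ provided that either $(\lambda_{n+1})_{n\in\mathbb{N}}\subset[0,\infty)$ satisfies (W1) $\lim_{n\to\infty}\lambda_n=0$, (W2) $\sum_{n\in\mathbb{N}}\lambda_{n+1}=+\infty$, (W3) $\sum_{n\in\mathbb{N}}|\lambda_{n+1}-\lambda_{n+2}|<\infty$; or $(\lambda_{n+1})_{n\in\mathbb{N}}\subset(0,\infty)$ satisfies (L1) $\lim_{n\to\infty}\lambda_n=0$, (L2) $\sum_{n\in\mathbb{N}}\lambda_{n+1}=+\infty$, (L3) $\lim_{n\to\infty}(\lambda_n-\lambda_{n+1})\lambda_{n+1}^{-2}=0$.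
   Context: $\mathcal{X}$ and $\mathcal{K}$ are real Hilbert spaces (not necessarily finite dimensional); product spaces carry the inner product given by the sum of the componentwise inner products. $\mathcal{B}(\mathcal{X},\mathcal{K})$ is the set of bounded linear operators, $A^*$ is the adjoint of $A$, $\|\cdot\|_{\rm op}$ is the operator norm. $\Gamma_0(\mathcal{X})$ is the set of proper lower semicontinuous convex functions $\mathcal{X}\to(-\infty,\infty]$; $\operatorname{dom}(f)=\{x: f(x)<\infty\}$. For a convex set $C$, $\operatorname{sri}(C)=\{x\in C:\operatorname{cone}(C-x)=\overline{\operatorname{span}}(C-x)\}$ where $\operatorname{cone}(S)=\{\lambda s:\lambda>0,s\in S\}$. $\operatorname{prox}_f(x)=\operatorname{argmin}_{y}\, f(y)+\frac12\|x-y\|^2$. $\nabla\Psi$ is strongly monotone over $\mathcal{X}$ if there is $\eta>0$ with $\langle\nabla\Psi(x)-\nabla\Psi(y),x-y\rangle\ge\eta\|x-y\|^2$ for all $x,y\in\mathcal{X}$. The hybrid steepest descent method for minimizing a Gâteaux differentiable convex function $\Theta$ over the fixed point set $\operatorname{Fix}(T)$ of a nonexpansive (i.e. $1$-Lipschitz) operator $T$ is the iteration $z_{n+1}=T(z_n)-\lambda_{n+1}\nabla\Theta(T(z_n))$; the displayed algorithm is this iteration for the operator $(1-\alpha)\mathrm{I}+\alpha\mathbf{T}_{\rm LAL}$ ($\mathrm{I}$ the identity) and $\Theta(x,y,\nu)=\Psi(x)+\frac{\eta_{xy}}{2}\|Ax-y\|^2+\frac{\eta_\nu}{2}\|\nu\|^2$.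 *)

(* Defs.v *)
From HB Require Import structures.
From mathcomp Require Import all_boot all_order all_algebra.
From mathcomp Require Import ring lra.
From mathcomp Require Import all_classical all_reals all_analysis.

Set Implicit Arguments.
Unset Strict Implicit.
Unset Printing Implicit Defensive.

Import Order.TTheory GRing.Theory Num.Theory.
Import numFieldNormedType.Exports.

Local Open Scope classical_set_scope.
Local Open Scope ring_scope.

HB.mixin Record NormedModule_hasInner (R : realType) H
    & NormedModule R H := {
  inner : H -> H -> R ;
  innerC : forall x y, inner x y = inner y x ;
  innerDl : forall x y z, inner (x + y) z = inner x z + inner y z ;
  innerZl : forall a x y, inner (a *: x) y = a * inner x y ;
  inner_norm : forall x, inner x x = `|x| ^+ 2
}.

#[short(type="hilbertType")]
HB.structure Definition Hilbert (R : realType) :=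
  {H of CompleteNormedModule R H & NormedModule_hasInner R H}.

(* The product of two Hilbert spaces, with inner product the sum of the
   componentwise ones. An alias of X * Y is needed because the library equips
   X * Y itself with the (equivalent, but not Hilbertian) maximum norm. *)
Definition hprod (X Y : Type) : Type := (X * Y)%type.

Section hprod.
Context {R : realType} {X Y : hilbertType R}.

HB.instance Definition _ := GRing.Lmodule.copy (hprod X Y) (X * Y)%type.

Implicit Types z w : hprod X Y.

Definition hprod_inner z w : R := inner z.1 w.1 + inner z.2 w.2.

Definition hprod_norm z : R := Num.sqrt (`|z.1| ^+ 2 + `|z.2| ^+ 2).

Let hprod_norm_ge0 z : 0 <= hprod_norm z. Proof. exact: sqrtr_ge0. Qed.

Let hprod_norm_sqr z : hprod_norm z ^+ 2 = `|z.1| ^+ 2 + `|z.2| ^+ 2.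
Proof. by rewrite sqr_sqrtr// addr_ge0// sqr_ge0. Qed.

Let hprod_normD z w : hprod_norm (z + w) <= hprod_norm z + hprod_norm w.
Proof.
have h : (`|z.1| * `|w.1| + `|z.2| * `|w.2|) <= hprod_norm z * hprod_norm w.
  rewrite -(@ler_pXn2r _ 2)// ?nnegrE ?addr_ge0 ?mulr_ge0//.
  rewrite exprMn !hprod_norm_sqr.
  have := sqr_ge0 (`|z.1| * `|w.2| - `|z.2| * `|w.1|).
  nra.
rewrite -(@ler_pXn2r _ 2)// ?nnegrE ?addr_ge0//.
rewrite sqrrD !hprod_norm_sqr.
have h1 : `|(z + w).1| ^+ 2 <= (`|z.1| + `|w.1|) ^+ 2.
  by rewrite ler_pXn2r// ?nnegrE ?addr_ge0// ler_normD.
have h2 : `|(z + w).2| ^+ 2 <= (`|z.2| + `|w.2|) ^+ 2.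
  by rewrite ler_pXn2r// ?nnegrE ?addr_ge0// ler_normD.
apply: (le_trans (lerD h1 h2)).
rewrite !sqrrD !mulr2n; lra.
Qed.

Let hprod_normZ (l : R) z : hprod_norm (l *: z) = `|l| * hprod_norm z.
Proof.
rewrite /hprod_norm /= !normrZ !exprMn -mulrDr sqrtrM ?sqr_ge0//.
by rewrite sqrtr_sqr normr_id.
Qed.

Let hprod_norm0_eq0 z : hprod_norm z = 0 -> z = 0.
Proof.
move=> z0; have := hprod_norm_sqr z; rewrite z0 expr0n/= => /esym/eqP.
rewrite paddr_eq0 ?sqr_ge0// !sqrf_eq0 !normr_eq0 => /andP[/eqP a /eqP b].
by case: z a b {z0} => /= a b -> ->.
Qed.

HB.instance Definition _ := @Lmodule_isNormed.Build R (hprod X Y)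
  hprod_norm hprod_normD hprod_normZ hprod_norm0_eq0.

Lemma hprod_normE z : `|z| = Num.sqrt (`|z.1| ^+ 2 + `|z.2| ^+ 2).
Proof. by []. Qed.

Let norm_fst z : `|z.1| <= `|z|.
Proof.
rewrite -(@ler_pXn2r _ 2)// ?nnegrE//.
by rewrite [leRHS]hprod_norm_sqr lerDl sqr_ge0.
Qed.

Let norm_snd z : `|z.2| <= `|z|.
Proof.
rewrite -(@ler_pXn2r _ 2)// ?nnegrE//.
by rewrite [leRHS]hprod_norm_sqr lerDr sqr_ge0.
Qed.

Let norm_le z : `|z| <= `|z.1| + `|z.2|.
Proof.
rewrite -(@ler_pXn2r _ 2)// ?nnegrE ?addr_ge0//.
rewrite [leLHS]hprod_norm_sqr sqrrD lerD2r lerDl mulrn_wge0//.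
Qed.

Let hprod_complete (F : set_system (hprod X Y)) :
  ProperFilter F -> cauchy F -> cvg F.
Proof.
move=> FF Fc.
have cauchy_proj (Z : hilbertType R) (p : hprod X Y -> Z) :
    (forall z w, `|p z - p w| <= `|z - w|) -> cvg (p @ F).
  move=> ple; apply: cauchy_cvg; apply/cauchy_ballP => e e0.
  move/cauchy_ballP : Fc => /(_ e e0) Fe.
  rewrite near_map2; apply: filterS Fe => -[z w] /=.
  by rewrite -!ball_normE /=; apply: le_lt_trans; exact: ple.
have cX : cvg ((fst : hprod X Y -> X) @ F).
  by apply: cauchy_proj => z w; exact: norm_fst (z - w).
have cY : cvg ((snd : hprod X Y -> Y) @ F).
  by apply: cauchy_proj => z w; exact: norm_snd (z - w).
apply/cvg_ex; exists ((lim ((fst : hprod X Y -> X) @ F),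
  lim ((snd : hprod X Y -> Y) @ F)) : hprod X Y).
apply/cvgrPdist_lt => e e0.
have e20 : 0 < e / 2 by rewrite divr_gt0.
move/cvgrPdist_lt : cX => /(_ _ e20) cX.
move/cvgrPdist_lt : cY => /(_ _ e20) cY.
near=> z.
apply: le_lt_trans (norm_le _) _.
rewrite [ltRHS]splitr ltrD//=; first by near: z.
by near: z.
Unshelve. all: by end_near. Qed.

HB.instance Definition _ := @Uniform_isComplete.Build (hprod X Y) hprod_complete.

Let hprod_innerC z w : hprod_inner z w = hprod_inner w z.
Proof. by rewrite /hprod_inner !(innerC z.1) !(innerC z.2). Qed.

Let hprod_innerDl z w t :
  hprod_inner (z + w) t = hprod_inner z t + hprod_inner w t.
Proof. by rewrite /hprod_inner /= !innerDl addrACA. Qed.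

Let hprod_innerZl a z w : hprod_inner (a *: z) w = a * hprod_inner z w.
Proof. by rewrite /hprod_inner /= !innerZl mulrDr. Qed.

Let hprod_inner_norm z : hprod_inner z z = `|z| ^+ 2.
Proof. by rewrite /hprod_inner !inner_norm [RHS]hprod_norm_sqr. Qed.

HB.instance Definition _ := @NormedModule_hasInner.Build R (hprod X Y)
  hprod_inner hprod_innerC hprod_innerDl hprod_innerZl hprod_inner_norm.

End hprod.

Definition argmin (T : Type) (R : realType) (F : T -> \bar R) (C : set T) :
    set T :=
  [set x | C x /\ forall y, C y -> (F x <= F y)%E].

Section convex_functions.
Context {R : realType} {H : hilbertType R}.
Implicit Types (f : H -> \bar R) (C S : set H).

Definition dom f : set H := [set x | (f x < +oo)%E].

Definition proper f := (forall x, f x != -oo%E) /\ dom f !=set0.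

Definition econvex f := forall (x y : H) (t : R), 0 < t -> t < 1 ->
  (f (t *: x + (1 - t) *: y)%R <= t%:E * f x + (1 - t)%:E * f y)%E.

Definition Gamma0 : set (H -> \bar R) :=
  [set f | [/\ proper f, lower_semicontinuous f & econvex f]].

Definition prox f (x : H) : H :=
  xget 0 (argmin (fun y => (f y + (2^-1 * `|x - y| ^+ 2)%:E)%E) [set: H]).

Definition cone S : set H := [set v | exists l s, [/\ 0 < l, S s & v = l *: s]].

Definition lspan S : set H :=
  [set v | exists n (c : 'I_n -> R) (s : 'I_n -> H),
    (forall i, S (s i)) /\ v = \sum_(i < n) c i *: s i].

Definition sri C : set H :=
  [set x | C x /\
    let D := [set c - x | c in C] in cone D = closure (lspan D)].

End convex_functions.

Section operators.
Context {R : realType} {H G : hilbertType R}.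

(* Extended-real valued, so that an unbounded operator has norm +oo. *)
Definition opnorm (L : H -> G) : \bar R :=
  ereal_sup [set `|L x|%:E | x in [set x : H | `|x| <= 1]].

(* The adjoint, chosen through its defining identity; for a bounded linear L
   the Riesz representation theorem makes the choice exist and be unique. *)
Definition adjoint (L : H -> G) (y : G) : H :=
  xget 0 [set x | forall z, inner (L z) y = inner z x].

End operators.

Section gradient.
Context {R : realType} {H : hilbertType R}.

Definition is_gradient (F : H -> R) (x g : H) :=
  forall v : H, is_derive x v F (inner g v).

Definition gateaux_differentiable (F : H -> R) :=
  forall x, exists g, is_gradient F x g.

Definition gradient (F : H -> R) (x : H) : H := xget 0 (is_gradient F x).

Definition strongly_monotone (T : H -> H) := exists2 eta : R, 0 < eta &
  forall x y, eta * `|x - y| ^+ 2 <= inner (T x - T y) (x - y).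

Definition nonexpansive (T : H -> H) := 1.-lipschitz T.

(* The step sizes are lam 1, lam 2, ...; the value lam 0 is irrelevant. *)
Definition hybrid_steepest_descent (T : H -> H) (Theta : H -> R)
    (lam : nat -> R) (z : nat -> H) :=
  [/\ nonexpansive T, econvex (EFin \o Theta), gateaux_differentiable Theta
    & forall n, z n.+1 = T (z n) - lam n.+1 *: gradient Theta (T (z n))].

End gradient.

Section step_sizes.
Context {R : realType}.
Implicit Types lam : nat -> R.

Definition stepsW lam :=
  [/\ forall n, 0 <= lam n.+1,
      lam @ \oo --> (0 : R),
      (\sum_(0 <= n <oo) (lam n.+1)%:E = +oo)%E
    & (\sum_(0 <= n <oo) `|lam n.+1 - lam n.+2|%:E < +oo)%E].

Definition stepsL lam :=
  [/\ forall n, 0 < lam n.+1,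
      lam @ \oo --> (0 : R),
      (\sum_(0 <= n <oo) (lam n.+1)%:E = +oo)%E
    & (fun n => (lam n - lam n.+1) * lam n.+1 ^- 2) @ \oo --> (0 : R)].

End step_sizes.

Section LAL.
Context {R : realType} {X K : hilbertType R}.

Definition Acheck (A : X -> K) (z : hprod X K) : K := A z.1 - z.2.

Definition TLAL (A : X -> K) (f : X -> \bar R) (g : K -> \bar R) (u : R)
    (z : hprod (hprod X K) K) : hprod (hprod X K) K :=
  let: (x, y, nu) := z in
  let A' := adjoint A in
  let xT := prox f (x - u ^+ 2 *: (A' (A x) - A' y) + u *: A' nu) in
  let yT := prox g (y - u ^+ 2 *: (- A x + y) - u *: nu) in
  let nuT := nu - u *: (A xT - yT) in
  (xT, yT, nuT).

Definition Theta_LAL (A : X -> K) (Psi : X -> R) (etaxy etanu : R)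
    (z : hprod (hprod X K) K) : R :=
  let: (x, y, nu) := z in
  Psi x + etaxy / 2 * `|A x - y| ^+ 2 + etanu / 2 * `|nu| ^+ 2.

End LAL.

(* Main.v *)
From HB Require Import structures.
Require Import Defs.
From mathcomp Require Import all_boot all_order all_algebra.
From mathcomp Require Import ring lra.
From mathcomp Require Import all_classical all_reals all_analysis.
Set Implicit Arguments.
Unset Strict Implicit.
Unset Printing Implicit Defensive.
Import Order.TTheory GRing.Theory Num.Theory.
Import numFieldNormedType.Exports.
Local Open Scope classical_set_scope.
Local Open Scope ring_scope.

(** Why the theorem holds.

    The operator [TLAL] is nonexpansive for the product norm: this follows
    from the firm nonexpansiveness of the two proximity operators together
    with [u * |A x - y| <= |(x, y)|] ([TLAL_nonexpansive]).  Its fixed points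
    are the triples [(x, A x, nu)] in which [x] is a primal solution and
    [- u *: nu] a Lagrange multiplier for the problem of minimizing
    [f x + g y] subject to [y = A x] ([TLAL_fixed], [fixed_TLAL]).  The two
    conditions are independent of each other, so every primal solution occurs
    with every multiplier ([fixed_of_Sp]).  On the fixed points the objective
    [Theta] reduces to [Psi x + etanu / 2 * |nu|^2]; its minimizer over them
    therefore has the minimizer of [Psi] over the primal solutions as its
    first component.

    That there are fixed points at all is strong duality, and it is here that
    the qualification condition is needed ([multiplier_exists]).  After adding
    a quadratic term that vanishes to second order at the primal solution, the
    value function of the perturbed problem is lower semicontinuous at the
    origin, so separation of its epigraph from points below it yields
    approximate multipliers.  By the qualification condition these may be
    taken in the closed subspace spanned by the feasible perturbations, where
    they are pointwise bounded; the uniform boundedness principle turns this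
    into a linear lower bound on the value function, and a second separation,
    this time of the generated cone, gives an exact multiplier.

    The gradient of [Theta] is Lipschitz continuous and strongly monotone, so
    the rest is the convergence theory of the hybrid steepest descent method
    for a nonexpansive [T] and such a gradient [G].  As in Browder's theorem,
    the solutions of [z - T z + s *: G z = 0] converge, as [s] tends to [0],
    to the minimizer [z0] of [Theta] over the fixed points
    ([steepest_descent_path]).  Monotonicity of [I - T] along this path also
    shows that the variational inequality of [z0] holds approximately at
    approximate fixed points, which replaces any use of weak compactness.  The
    iterates are bounded and asymptotically regular under either step size
    regime, so their squared distances to [z0] satisfy a recursive inequality
    that forces them to [0] ([recursive_inequality_cvg0],
    [hybrid_steepest_descent_cvg]).

    All existence statements (projections, adjoints, proximal points, lower
    semicontinuity of the value function) rest on one principle: nearly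
    minimizing sequences of a uniformly convex function are Cauchy
    ([uniformly_convex_minimization]). *)

(** * Inner product spaces and uniformly convex minimization *)

Section inner.
Context {R : realType} {H : hilbertType R}.
Implicit Types (x y z : H) (a : R).

Lemma innerDr x y z : inner x (y + z) = inner x y + inner x z.
Proof. by rewrite innerC innerDl !(innerC x). Qed.

Lemma innerZr a x y : inner x (a *: y) = a * inner x y.
Proof. by rewrite innerC innerZl innerC. Qed.

Lemma innerNl x y : inner (- x) y = - inner x y.
Proof. by rewrite -scaleN1r innerZl mulN1r. Qed.

Lemma innerNr x y : inner x (- y) = - inner x y.
Proof. by rewrite innerC innerNl innerC. Qed.

Lemma inner0l x : inner 0 x = 0.
Proof. by rewrite -(scale0r (0 : H)) innerZl mul0r. Qed.

Lemma inner0r x : inner x 0 = 0.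
Proof. by rewrite innerC inner0l. Qed.

Definition innerE := (@innerDl R H, @innerDr, @innerZl R H, @innerZr,
  @innerNl, @innerNr, @inner0l, @inner0r).

Lemma cauchy_schwarz x y : inner x y <= `|x| * `|y|.
Proof.
have [->|x0] := eqVneq x 0; first by rewrite inner0l normr0 mul0r.
have [->|y0] := eqVneq y 0; first by rewrite inner0r normr0 mulr0.
have nx : 0 < `|x| by rewrite normr_gt0.
have ny : 0 < `|y| by rewrite normr_gt0.
have := sqr_ge0 `| `|y| *: x - `|x| *: y|.
rewrite -inner_norm !innerE (innerC y x) !inner_norm => h.
have {}h : 0 <= (2 * (`|x| * `|y|)) * (`|x| * `|y| - inner x y).
  by apply: (le_trans h); rewrite le_eqVlt; apply/orP; left; apply/eqP; ring.
by rewrite pmulr_rge0 ?subr_ge0// in h; rewrite !mulr_gt0.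
Qed.

Lemma cauchy_schwarz_abs x y : `|inner x y| <= `|x| * `|y|.
Proof.
rewrite ler_norml cauchy_schwarz andbT lerNl -innerNl -(normrN x).
exact: cauchy_schwarz.
Qed.

Lemma inner_ext x y : (forall z, inner x z = inner y z) -> x = y.
Proof.
move=> xy; apply/eqP; rewrite -subr_eq0 -normr_eq0 -sqrf_eq0 -inner_norm.
by rewrite innerDl innerNl xy subrr.
Qed.

Lemma sqnormB x y : `|x - y| ^+ 2 = `|x| ^+ 2 - 2 * inner x y + `|y| ^+ 2.
Proof. rewrite -!inner_norm !innerE (innerC y x); ring. Qed.

Lemma sqnormD x y : `|x + y| ^+ 2 = `|x| ^+ 2 + 2 * inner x y + `|y| ^+ 2.
Proof. rewrite -!inner_norm !innerE (innerC y x); ring. Qed.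

Lemma sqnorm_midpoint x y z :
  `|z - 2^-1 *: (x + y)| ^+ 2 =
  2^-1 * (`|z - x| ^+ 2 + `|z - y| ^+ 2) - 4^-1 * `|x - y| ^+ 2.
Proof.
rewrite -!inner_norm !innerE (innerC y x) !(innerC x z) !(innerC y z); by field.
Qed.

Lemma cvg_inner {T : Type} {F : set_system T} {FF : Filter F}
    (f g : T -> H) (a b : H) :
  f @ F --> a -> g @ F --> b -> (fun t => inner (f t) (g t)) @ F --> inner a b.
Proof.
move=> fa gb.
have iE x y : inner x y = 2^-1 * (`|x + y| ^+ 2 - `|x| ^+ 2 - `|y| ^+ 2).
  by rewrite sqnormD; field.
rewrite iE; under eq_fun do rewrite iE.
apply: cvgM; first exact: cvg_cst.
have sq (h : T -> H) c : h @ F --> c -> (fun t => `|h t| ^+ 2) @ F --> `|c| ^+ 2.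
  by move=> hc; rewrite !expr2; apply: cvgM; apply: cvg_norm.
by apply: cvgB; [apply: cvgB|]; apply: sq => //; apply: cvgD.
Qed.

Lemma cvg_sqnorm {T : Type} {F : set_system T} {FF : Filter F}
    (f : T -> H) (a : H) :
  f @ F --> a -> (fun t => `|f t| ^+ 2) @ F --> `|a| ^+ 2.
Proof.
move=> fa; rewrite -inner_norm; under eq_fun do rewrite -inner_norm.
exact: cvg_inner.
Qed.

End inner.

Section limits.
Context {R : realType}.

Lemma cvgn_le (u v : nat -> R) a b :
  u @ \oo --> a -> v @ \oo --> b -> (forall n, u n <= v n) -> a <= b.
Proof.
move=> ua vb uv; rewrite -(cvg_lim _ ua)// -(cvg_lim _ vb)//.
by apply: ler_lim; [apply/cvg_ex; exists a|apply/cvg_ex; exists b|exact: nearW].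
Qed.

(** The form in which first-order conditions are extracted from inequalities
    along a segment: divide by [t] and let [t] tend to [0]. *)
Lemma ge0_of_small_quadratic (a b : R) :
  (forall t, 0 < t -> t < 1 -> 0 <= t * a + t ^+ 2 * b) -> 0 <= a.
Proof.
move=> h; rewrite leNgt; apply/negP => a0.
pose t := - a / (2 * (`|b| - a) + 1).
have b0 := normr_ge0 b; have bb := ler_norm b.
have d0 : 0 < 2 * (`|b| - a) + 1 by lra.
have t0 : 0 < t by rewrite /t divr_gt0//; lra.
have t1 : t < 1 by rewrite /t ltr_pdivrMr//; lra.
have : 0 <= t * (a + t * b) by have := h _ t0 t1; rewrite mulrDr mulrA -expr2.
rewrite pmulr_rge0// => h1.
have : t * (2 * (`|b| - a) + 1) = - a by rewrite /t divfK// gt_eqF.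
have : t * b <= t * `|b| by rewrite ler_pM2l.
nra.
Qed.

End limits.

Lemma cvgn_of_sqdist {R : realType} {H : hilbertType R} (z : nat -> H)
    (e : nat -> R) :
  (forall j k, (k <= j)%N -> `|z j - z k| ^+ 2 <= e k) -> e @ \oo --> (0 : R) ->
  exists l : H, z @ \oo --> l.
Proof.
move=> ze e0; suff : cvgn z by move/cvg_ex.
apply/cauchy_cvgP; apply: cauchy_exP => d d0.
have d2 : 0 < d ^+ 2 by rewrite exprn_gt0.
have [N _ NP] : \forall k \near \oo, e k < d ^+ 2.
  exact: (cvgr_lt (0 : R) e0).
exists (z N); exists N => // j /= Nj; rewrite -ball_normE /=.
rewrite -(@ltr_pXn2r _ 2)// ?nnegrE ?(ltW d0)// distrC.
exact: le_lt_trans (ze _ _ Nj) (NP _ (leqnn N)).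
Qed.

(** If [z j] and [z k] nearly minimize [phi] over [S j] and [S k] with
    [k <= j], their midpoint is feasible for [S k], so uniform convexity bounds
    their distance by the gap between the minimal value over [S k] and the
    limit of the minimal values.  Letting the feasible sets shrink with [k]
    covers limits of constrained problems as well as single problems. *)
Lemma uniformly_convex_minimization {R : realType} {H : hilbertType R}
    (S : nat -> set H) (phi : H -> R) (c M b : R) :
  0 < c ->
  (forall k, S k.+1 `<=` S k) ->
  (forall k x y, S k x -> S k y -> S k (2^-1 *: (x + y))) ->
  (forall x y, S 0%N x -> S 0%N y ->
    phi (2^-1 *: (x + y)) + c * `|x - y| ^+ 2 <= 2^-1 * (phi x + phi y)) ->
  (forall x, S 0%N x -> b <= phi x) ->
  (forall k, exists2 x, S k x & phi x <= M) ->
  exists (z : H) (zs : nat -> H) (mu : R),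
    [/\ forall k, S k (zs k), zs @ \oo --> z, phi \o zs @ \oo --> mu,
        mu <= M & forall w, (forall k, S k w) -> mu <= phi w].
Proof.
move=> c0 Sdec Smid phimid phib phiM.
have SW j k x : (j <= k)%N -> S k x -> S j x.
  elim: k => [|k IH]; first by rewrite leqn0 => /eqP ->.
  by rewrite leq_eqVlt ltnS => /orP[/eqP ->//|jk] /Sdec; exact: IH.
have S0 k x : S k x -> S 0%N x by exact: SW.
pose I k := inf (phi @` S k).
have hinf k : has_inf (phi @` S k).
  split; first by have [x Sx _] := phiM k; exists (phi x), x.
  by exists b => _ [x Sx <-]; apply: phib; exact: S0 Sx.
have Ile k x : S k x -> I k <= phi x.
  by move=> Sx; apply: ge_inf; [exact: (hinf k).2|exists x].
have IM k : I k <= M by have [x Sx /(le_trans (Ile _ _ Sx))] := phiM k.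
have Imono : nondecreasing_seq I.
  move=> j k jk; apply: lb_le_inf; first exact: (hinf k).1.
  by move=> _ [x Sx <-]; apply: Ile; exact: SW Sx.
have Icvg : I @ \oo --> sup (range I).
  apply: nondecreasing_cvgn => //; exists M => _ [k _ <-]; exact: IM.
set mu := sup _ in Icvg.
have Imu k : I k <= mu.
  by apply: ub_le_sup; [exists M => _ [j _ <-]|exists k].
have [zs zsP] : {zs : nat -> H & forall k, S k (zs k) /\ phi (zs k) < I k + k.+1%:R^-1}.
  apply: (@choice _ _ (fun k z => S k z /\ phi z < I k + k.+1%:R^-1)) => k.
  have k0 : 0 < k.+1%:R^-1 :> R by rewrite invr_gt0.
  by have [_ [z Sz <-] zI] := inf_adherent k0 (hinf k); exists z.
have zsS k : S k (zs k) by have [] := zsP k.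
have dist j k : (k <= j)%N ->
    c * `|zs j - zs k| ^+ 2 <= 2^-1 * (mu - I k) + k.+1%:R^-1.
  move=> kj; have Sj := SW _ _ _ kj (zsS j).
  have := phimid _ _ (S0 _ _ Sj) (S0 _ _ (zsS k)).
  have := Ile _ _ (Smid _ _ _ Sj (zsS k)).
  have := (zsP j).2; have := (zsP k).2; have := Imu j; have := Imu k.
  have : j.+1%:R^-1 <= k.+1%:R^-1 :> R by rewrite lef_pV2 ?posrE// ler_nat.
  move: (j.+1%:R^-1) (k.+1%:R^-1) => ej ek; lra.
have [z zz] : exists z : H, zs @ \oo --> z.
  pose e k := c^-1 * (2^-1 * (mu - I k) + k.+1%:R^-1).
  apply: (@cvgn_of_sqdist _ _ _ e) => [j k kj|].
    by rewrite /e mulrC ler_pdivlMr// mulrC; exact: dist.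
  rewrite -(mulr0 c^-1); apply: cvgM; first exact: cvg_cst.
  rewrite -[0](addr0 (0 : R)); apply: cvgD; last exact: cvg_harmonic.
  rewrite -(mulr0 (2^-1 : R)); apply: cvgM; first exact: cvg_cst.
  by rewrite -(subrr mu); apply: cvgB => //; exact: cvg_cst.
exists z, zs, mu; split => //.
- apply: (@squeeze_cvgr _ _ _ _ I (fun k => I k + k.+1%:R^-1)) => //.
  + apply: nearW => k /=; rewrite (Ile _ _ (zsS k))/=; exact: ltW (zsP k).2.
  + rewrite -[mu]addr0; apply: cvgD => //; exact: cvg_harmonic.
- by apply: ge_sup; [exists (I 0%N), 0%N|move=> _ [k _ <-]].
- move=> w Sw; apply: ge_sup; first by exists (I 0%N), 0%N.
  by move=> _ [k _ <-]; exact: Ile.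
Qed.

(** * Convex lower semicontinuous functions and proximal points *)

Lemma segmentE {R : realType} {V : lmodType R} (t : R) (x y : V) :
  t *: x + (1 - t) *: y = y + t *: (x - y).
Proof. by rewrite scalerBl scale1r scalerBr addrCA. Qed.

Lemma midpointE {R : realType} {V : lmodType R} (x y : V) :
  2^-1 *: (x + y) = 2^-1 *: x + (1 - 2^-1) *: y.
Proof. by rewrite scalerDr; congr (_ + _ *: _); field. Qed.

Section epigraph.
Context {R : realType} {H : hilbertType R}.
Implicit Types (f : H -> \bar R) (x y : H) (r s t : R).

Lemma econvex_le f x y r s t : econvex f -> 0 < t -> t < 1 ->
  (f x <= r%:E)%E -> (f y <= s%:E)%E ->
  (f (t *: x + (1 - t) *: y)%R <= (t * r + (1 - t) * s)%:E)%E.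
Proof.
move=> cf t0 t1 fx fy; apply: (le_trans (cf _ _ _ t0 t1)).
have t1' : 0 < 1 - t by rewrite subr_gt0.
by rewrite (EFinD (t * r)) !EFinM leeD// lee_pmul2l.
Qed.

Lemma lsc_le f (u : nat -> H) (v : nat -> R) x r : lower_semicontinuous f ->
  u @ \oo --> x -> v @ \oo --> r -> (forall n, (f (u n) <= (v n)%:E)%E) ->
  (f x <= r%:E)%E.
Proof.
move=> lf ux vr fuv; rewrite leNgt; apply/negP => rf.
have [a ra af] : exists2 a : R, r < a & (a%:E < f x)%E.
  case: (f x) rf => [c||//].
  - rewrite lte_fin => rc; exists (2^-1 * (r + c)); rewrite ?lte_fin; lra.
  - by move=> _; exists (r + 1); rewrite ?ltrDl// ltry.
have [V Vx Va] := lf _ _ af.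
have [n [Vn va]] : exists n, V (u n) /\ v n < a.
  have hV : \forall n \near \oo, V (u n) by exact: ux.
  have hv : \forall n \near \oo, v n < a by exact: (cvgr_lt r vr).
  by have [N _ NP] := filterI hV hv; exists N; exact: (NP N (leqnn N)).
have := lt_le_trans (Va _ Vn) (fuv n).
by rewrite lte_fin => /(lt_trans va); rewrite ltxx.
Qed.

Lemma Gamma0_fin f x s : Gamma0 f -> (f x <= s%:E)%E ->
  f x = (fine (f x))%:E.
Proof.
move=> [[nf _] _ _] fs; rewrite fineK// fin_numE nf/=.
by apply/eqP => fx; rewrite fx in fs.
Qed.

Lemma Gamma0_dom f x : Gamma0 f -> dom f x -> (f x <= (fine (f x))%:E)%E.
Proof. by move=> [[nf _] _ _] fx; rewrite fineK// fin_numE nf/= lt_eqF. Qed.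

(** Lower semicontinuity bounds [f] below on a ball around a point of its
    domain, and convexity turns this into a lower bound decreasing at most
    linearly at infinity. *)
Lemma Gamma0_minorant f : Gamma0 f -> exists r L,
  0 <= L /\ forall x s, (f x <= s%:E)%E -> r - L * `|x| <= s.
Proof.
move=> Gf; have [[nf [x0 fx0]] lf cf] := Gf.
have fx0E : f x0 = (fine (f x0))%:E.
  by rewrite fineK// fin_numE nf/= lt_eqF.
set r0 := fine (f x0) in fx0E.
have [V] : exists2 V, nbhs x0 V & forall y, V y -> ((r0 - 1)%:E < f y)%E.
  by apply: lf; rewrite fx0E lte_fin; lra.
move=> /nbhs_normP[d /= d0 dV] Vf.
have near x s : `|x - x0| < d -> (f x <= s%:E)%E -> r0 - 1 <= s.
  move=> xd fs; have := Vf x; rewrite -lee_fin => /(_ _)/ltW h.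
  by apply: le_trans fs; apply: h; apply: dV; rewrite /= distrC.
exists (r0 - 1 - (2 / d) * `|x0|), (2 / d); split; first by rewrite divr_ge0// ltW.
move=> x s fs.
have tri : `|x - x0| <= `|x| + `|x0| by exact: ler_normB.
suff : r0 - 1 - 2 / d * `|x - x0| <= s.
  move=> h; apply: le_trans h.
  have : 2 / d * `|x - x0| <= 2 / d * (`|x| + `|x0|).
    by rewrite ler_wpM2l// divr_ge0// ltW.
  lra.
have [xd|xd] := ltP `|x - x0| d.
  have := near _ _ xd fs.
  have : 0 <= 2 / d * `|x - x0| by rewrite mulr_ge0// divr_ge0// ltW.
  lra.
set D := `|x - x0| in xd *.
have D0 : 0 < D by exact: lt_le_trans xd.
pose t := d / (2 * D).
have t0 : 0 < t by rewrite divr_gt0// mulr_gt0.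
have tD : t * D = d / 2 by rewrite /t; field; rewrite gt_eqF.
have t1 : t < 1 by rewrite /t ltr_pdivrMr ?mulr_gt0//; lra.
have : r0 - 1 <= t * s + (1 - t) * r0.
  apply: (near (t *: x + (1 - t) *: x0)).
    rewrite segmentE addrAC subrr add0r normrZ (ger0_norm (ltW t0)) -/D tD; lra.
  by apply: econvex_le => //; rewrite fx0E.
have tdE : t * (2 / d * D) = 1 by rewrite /t; field; rewrite !gt_eqF.
move=> h; rewrite -(ler_pM2l t0) !mulrBr tdE; lra.
Qed.

(** The quadratic term dominates the linear decrease of the minorant. *)
Lemma sqnorm_reg_ge f w : Gamma0 f -> exists b, forall x s,
  (f x <= s%:E)%E -> b <= s + 2^-1 * `|w - x| ^+ 2.
Proof.
move=> /Gamma0_minorant[r [L [L0 fr]]].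
exists (r - L * `|w| - 2^-1 * L ^+ 2) => x s /fr h.
have tri : `|x| <= `|w| + `|w - x|.
  by rewrite -{1}(subKr w x); exact: ler_normB.
have : L * `|x| <= L * (`|w| + `|w - x|) by rewrite ler_wpM2l.
have := sqr_ge0 (L - `|w - x|); rewrite sqrrB; lra.
Qed.

Lemma sqnorm_reg_midpoint f w x y r s : econvex f ->
  (f x <= r%:E)%E -> (f y <= s%:E)%E ->
  exists2 m, (f (2^-1 *: (x + y))%R <= m%:E)%E &
    m + 2^-1 * `|w - 2^-1 *: (x + y)| ^+ 2 + 8^-1 * `|x - y| ^+ 2 =
    2^-1 * ((r + 2^-1 * `|w - x| ^+ 2) + (s + 2^-1 * `|w - y| ^+ 2)).
Proof.
move=> cf fx fy; exists (2^-1 * r + (1 - 2^-1) * s).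
  by rewrite midpointE; apply: econvex_le => //; lra.
rewrite sqnorm_midpoint; lra.
Qed.

(** Lower semicontinuity puts the limit of the nearly minimizing points in the
    epigraph of [f], at a level no higher than the limit of the minimal
    values of [f + |. - w|^2 / 2] over the sets [S k]. *)
Lemma sqnorm_reg_minimization f w (S : nat -> set H) (M : R) :
  Gamma0 f ->
  (forall k, S k.+1 `<=` S k) ->
  (forall k x y, S k x -> S k y -> S k (2^-1 *: (x + y))) ->
  (forall k, exists2 x, S k x & exists2 s, (f x <= s%:E)%E &
     s + 2^-1 * `|w - x| ^+ 2 <= M) ->
  exists (z : H) (zs : nat -> H) (r : R),
    [/\ forall k, S k (zs k), zs @ \oo --> z, (f z <= r%:E)%E,
        r + 2^-1 * `|w - z| ^+ 2 <= M &
        forall x s, (forall k, S k x) -> (f x <= s%:E)%E ->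
          r + 2^-1 * `|w - z| ^+ 2 <= s + 2^-1 * `|w - x| ^+ 2].
Proof.
move=> Gf Sdec Smid SM; have [_ lf cf] := Gf.
have domE x : dom f x -> (f x <= (fine (f x))%:E)%E by exact: Gamma0_dom.
have fine_le x s : (f x <= s%:E)%E -> fine (f x) <= s.
  by move=> fs; rewrite -lee_fin -(Gamma0_fin Gf fs).
have dom_le x s : (f x <= s%:E)%E -> dom f x.
  by move=> fs; apply: le_lt_trans fs _; rewrite ltry.
pose phi x := fine (f x) + 2^-1 * `|w - x| ^+ 2.
have [b bP] := sqnorm_reg_ge w Gf.
have [] := @uniformly_convex_minimization R H (fun k => S k `&` dom f) phi 8^-1 M b.
- by rewrite invr_gt0.
- by move=> k x [/Sdec].
- move=> k x y [Sx fx] [Sy fy]; split; first exact: Smid.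
  by have [m /dom_le] := sqnorm_reg_midpoint w cf (domE _ fx) (domE _ fy).
- move=> x y [_ fx] [_ fy].
  have [m /fine_le fm <-] := sqnorm_reg_midpoint w cf (domE _ fx) (domE _ fy).
  by rewrite /phi lerD2r lerD2r.
- by move=> x [_ /domE]; exact: bP.
- move=> k; have [x Sx [s fs sM]] := SM k.
  exists x; first by split => //; exact: dom_le fs.
  by apply: le_trans sM; rewrite lerD2r fine_le.
move=> z [zs [mu [zsS zsz phimu muM mule]]].
have regz : (fun k => 2^-1 * `|w - zs k| ^+ 2) @ \oo --> 2^-1 * `|w - z| ^+ 2.
  apply: cvgM; first exact: cvg_cst.
  by apply: cvg_sqnorm; apply: cvgB => //; exact: cvg_cst.
exists z, zs, (mu - 2^-1 * `|w - z| ^+ 2); split.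
- by move=> k; have [] := zsS k.
- exact: zsz.
- apply: (@lsc_le _ _ (fun k => phi (zs k) - 2^-1 * `|w - zs k| ^+ 2)) zsz _ _ => //.
    exact: cvgB.
  by move=> k; rewrite /phi addrK; apply: domE; exact: (zsS k).2.
- by rewrite subrK.
- move=> x s Sx fs; rewrite subrK; apply: (@le_trans _ _ (phi x)).
    by apply: mule => k; split => //; exact: dom_le fs.
  by rewrite lerD2r fine_le.
Qed.

(** The variational inequality is the first-order condition for minimality
    of [p] along the segment towards [x]. *)
Lemma prox_exists f w : Gamma0 f -> exists p r, f p = r%:E /\
  forall x s, (f x <= s%:E)%E -> r + inner (w - p) (x - p) <= s.
Proof.
move=> Gf; have [[_ [x0 fx0]] _ cf] := Gf.
have fx0E := Gamma0_dom Gf fx0.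
have [|||p [_ [r' [_ _ fp _ pmin]]]] := @sqnorm_reg_minimization f w
    (fun=> setT) (fine (f x0) + 2^-1 * `|w - x0| ^+ 2) Gf => //.
  by move=> _; exists x0 => //; exists (fine (f x0)).
have fpE := Gamma0_fin Gf fp.
set r := fine (f p) in fpE; exists p, r; split => // x s fs.
suff : 0 <= s - r - inner (w - p) (x - p) by lra.
apply: (@ge0_of_small_quadratic _ _ (2^-1 * `|x - p| ^+ 2)) => t t0 t1.
have fpr : (f p <= r%:E)%E by rewrite fpE.
have := pmin _ _ (fun=> Logic.I) (econvex_le cf t0 t1 fs fpr).
have rr' : r <= r' by rewrite -lee_fin -fpE.
rewrite (segmentE t x p) opprD addrA (sqnormB (w - p)) innerZr normrZ exprMn.
rewrite (ger0_norm (ltW t0)).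
lra.
Qed.

(** Expanding the square at [x] turns the variational inequality into strong
    minimality of [p], so the choice made by [prox] can only return [p]. *)
Lemma prox_unique f w p r : f p = r%:E ->
  (forall x s, (f x <= s%:E)%E -> r + inner (w - p) (x - p) <= s) ->
  prox f w = p.
Proof.
move=> fp vi.
have key x s : (f x <= s%:E)%E ->
    r + 2^-1 * `|w - p| ^+ 2 + 2^-1 * `|x - p| ^+ 2 <= s + 2^-1 * `|w - x| ^+ 2.
  move=> /vi; have -> : w - x = (w - p) - (x - p) by rewrite opprB addrA subrK.
  rewrite (sqnormB (w - p)); lra.
rewrite /prox; case: xgetP => [q _ [_ /(_ p Logic.I) qmin]|/(_ p)[]].
  move: qmin; rewrite fp -EFinD => qmin.
  have [s fs sE] : exists2 s, (f q <= s%:E)%E &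
      s + 2^-1 * `|w - q| ^+ 2 <= r + 2^-1 * `|w - p| ^+ 2.
    case: (f q) qmin => [s| |] //=.
      by rewrite -EFinD lee_fin; exists s.
    move=> _; exists (r + 2^-1 * `|w - p| ^+ 2 - 2^-1 * `|w - q| ^+ 2).
      by rewrite leNye.
    by rewrite subrK.
  have := key _ _ fs => h.
  have : `|q - p| ^+ 2 <= 0 by have := sqr_ge0 `|q - p|; lra.
  rewrite le_eqVlt ltNge sqr_ge0 orbF sqrf_eq0 normr_eq0 subr_eq0.
  by move/eqP.
split => // x _; rewrite fp -EFinD.
case fx : (f x) => [s| |].
- rewrite -EFinD lee_fin.
  have := @key x s; rewrite fx lexx => /(_ isT).
  have := sqr_ge0 `|x - p|; lra.
- by rewrite addye// leey.
- exfalso; have := @key x (r + 2^-1 * `|w - p| ^+ 2 - 2^-1 * `|w - x| ^+ 2 - 1).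
  rewrite fx leNye => /(_ isT).
  have := sqr_ge0 `|x - p|; lra.
Qed.

Lemma proxP f w : Gamma0 f -> exists r, f (prox f w) = r%:E /\
  forall x s, (f x <= s%:E)%E -> r + inner (w - prox f w) (x - prox f w) <= s.
Proof.
move=> /(@prox_exists _ w)[p [r [fp vi]]].
by rewrite (prox_unique fp vi); exists r.
Qed.

End epigraph.

(** * Projections, separation and adjoints *)

(** The real line as a Hilbert space, so that epigraphs of functions on [H]
    are subsets of the Hilbert space [hprod H R^o]. *)
Section real_line.
Context {R : realType}.
Let real_innerC (x y : R^o) : x * y = y * x :> R. Proof. exact: mulrC. Qed.
Let real_innerDl (x y z : R^o) : (x + y) * z = x * z + y * z :> R.
Proof. exact: mulrDl. Qed.
Let real_innerZl a (x y : R^o) : (a *: x) * y = a * (x * y) :> R.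
Proof. by rewrite mulrA. Qed.
Let real_inner_norm (x : R^o) : x * x = `|x| ^+ 2 :> R.
Proof. by rewrite real_normK ?num_real// expr2. Qed.
HB.instance Definition _ := @NormedModule_hasInner.Build R R^o
  (fun x y : R => x * y) real_innerC real_innerDl real_innerZl real_inner_norm.
End real_line.

Section hprod_facts.
Context {R : realType} {X Y : hilbertType R}.
Implicit Types z w : hprod X Y.

Lemma hprod_innerE z w : inner z w = inner z.1 w.1 + inner z.2 w.2.
Proof. by []. Qed.

Lemma hprod_sqnorm z : `|z| ^+ 2 = `|z.1| ^+ 2 + `|z.2| ^+ 2.
Proof. by rewrite -inner_norm hprod_innerE !inner_norm. Qed.

Lemma hprod_norm_fst z : `|z.1| <= `|z|.
Proof. by rewrite -(@ler_pXn2r _ 2)// ?nnegrE// hprod_sqnorm lerDl sqr_ge0. Qed.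

Lemma hprod_norm_snd z : `|z.2| <= `|z|.
Proof. by rewrite -(@ler_pXn2r _ 2)// ?nnegrE// hprod_sqnorm lerDr sqr_ge0. Qed.

End hprod_facts.

Section projection.
Context {R : realType} {H : hilbertType R}.
Implicit Types (C V : set H) (x y : H).

Definition convex_subset C := forall x y (t : R), 0 < t -> t < 1 ->
  C x -> C y -> C (t *: x + (1 - t) *: y).

Lemma projection_exists C x : convex_subset C -> C !=set0 ->
  exists (q : H) (qs : nat -> H), [/\ forall k, C (qs k), qs @ \oo --> q &
    forall c, C c -> inner (x - q) (c - q) <= 0].
Proof.
move=> cC [c0 Cc0].
have [||k y z Cy Cz|y z _ _|y _|k|q [qs [mu [Cqs qsq phimu _ mule]]]] :=
  @uniformly_convex_minimization R H (fun=> C) (fun y => `|x - y| ^+ 2) 4^-1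
    (`|x - c0| ^+ 2) 0.
- by rewrite invr_gt0.
- by move=> _ z.
- by rewrite midpointE; apply: cC => //; lra.
- by rewrite sqnorm_midpoint subrK.
- exact: sqr_ge0.
- by exists c0.
exists q, qs; split => // c Cc.
have xqs (t : R) : (fun k => `|x - (t *: c + (1 - t) *: qs k)| ^+ 2) @ \oo -->
    `|x - (t *: c + (1 - t) *: q)| ^+ 2.
  apply: cvg_sqnorm; apply: cvgB; first exact: cvg_cst.
  by apply: cvgD; [exact: cvg_cst|apply: cvgZr].
have muE : mu = `|x - q| ^+ 2.
  have := xqs 0; under eq_fun do rewrite scale0r add0r subr0 scale1r.
  rewrite scale0r add0r subr0 scale1r => h.
  by rewrite -(cvg_lim _ phimu)// -(cvg_lim _ h).
suff : 0 <= - (2 * inner (x - q) (c - q)) by lra.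
apply: (@ge0_of_small_quadratic _ _ (`|c - q| ^+ 2)) => t t0 t1.
have : mu <= `|x - (t *: c + (1 - t) *: q)| ^+ 2.
  apply: (cvgn_le (u := fun=> mu) _ (xqs t)); first exact: cvg_cst.
  by move=> k; apply: mule => _; exact: cC.
rewrite muE segmentE opprD addrA (sqnormB (x - q)) innerZr normrZ exprMn.
rewrite (ger0_norm (ltW t0)); lra.
Qed.

(** The normal is [q - x], with [q] the projection of [x] on the closure of
    [C]. *)
Lemma separation C x d : convex_subset C -> C !=set0 ->
  (forall c, C c -> d <= `|c - x| ^+ 2) ->
  exists a, forall c, C c -> d <= inner a (c - x).
Proof.
move=> cC C0 dC; have [q [qs [Cqs qsq vi]]] := projection_exists x cC C0.
exists (q - x) => c Cc.
have dq : d <= `|q - x| ^+ 2.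
  apply: (@cvgn_le _ (fun=> d) (fun k => `|qs k - x| ^+ 2)).
  - exact: cvg_cst.
  - by apply: cvg_sqnorm; apply: cvgB => //; exact: cvg_cst.
  - by move=> k; apply: dC.
have -> : c - x = (c - q) + (q - x) by rewrite addrA subrK.
rewrite innerDr inner_norm; have := vi _ Cc.
by rewrite -(opprB q x) innerNl; lra.
Qed.

(** On a subspace the variational inequality of the projection may be tested
    in the directions [w] and [- w], hence is an equality. *)
Lemma orthogonal_projection V x : closed V -> V 0 ->
  (forall y z, V y -> V z -> V (y + z)) ->
  (forall (a : R) y, V y -> V (a *: y)) ->
  exists2 v, V v & forall w, V w -> inner x w = inner v w.
Proof.
move=> clV V0 VD VZ.
have cV : convex_subset V by move=> y z t _ _ Vy Vz; apply: VD; exact: VZ.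
have [|q [qs [Vqs qsq vi]]] := projection_exists x cV; first by exists 0.
have Vq : V q.
  exact: (@closed_cvg _ _ _ _ qs V clV (nearW _ Vqs) q qsq).
exists q => // w Vw; apply/eqP; rewrite -subr_eq0 -innerNl -innerDl eq_le.
have := vi _ (VD _ _ Vq Vw); have := vi _ (VD _ _ Vq (VZ (-1) _ Vw)).
rewrite !(addrC q) !addrK scaleN1r innerNr => h1 ->; lra.
Qed.

End projection.

Section bounded_operators.
Context {R : realType} {H G : hilbertType R}.

Lemma bounded_linearP (L : {linear H -> G}) : bounded_near L (nbhs (0 : H)) ->
  exists2 b : R, 0 < b & forall x, `|L x| <= b * `|x|.
Proof. by move=> /linear_boundedP/pinfty_ex_gt0[b b0 bL]; exists b. Qed.

Lemma bounded_linear_cvg (L : {linear H -> G}) (u : nat -> H) x :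
  bounded_near L (nbhs (0 : H)) -> u @ \oo --> x -> (L \o u) @ \oo --> L x.
Proof.
by move=> bL ux; apply: continuous_cvg => //; exact: bounded_linear_continuous.
Qed.

(** The adjoint at [y] is the proximal point of [0] for the linear function
    [z |-> - <L z, y>], which is in effect the Riesz representation theorem. *)
Lemma adjointP (L : {linear H -> G}) y z : bounded_near L (nbhs (0 : H)) ->
  inner (L z) y = inner z (adjoint L y).
Proof.
move=> bL; suff [p pP] : exists p, forall z, inner (L z) y = inner z p.
  by rewrite /adjoint; case: xgetP => [q _ ->//|/(_ p)[]].
pose f z := (- inner (L z) y)%:E.
have Gf : Gamma0 f.
  split; first by split => [//|]; exists 0; rewrite /dom/= ltry.
  - move=> x a ax; exists [set z | (a%:E < f z)%E] => //.
    have Lx : (fun z => - inner (L z) y) @ x --> - inner (L x) y.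
      apply: cvgN; apply: cvg_inner; last exact: cvg_cst.
      exact: bounded_linear_continuous.
    by apply: (cvgr_gt _ Lx); rewrite -lte_fin.
  - move=> u v t _ _; rewrite /f -!EFinM -EFinD lee_fin linearD !linearZ/=.
    by rewrite !innerE; lra.
have [p [r [fp vi]]] := prox_exists 0 Gf.
exists p => {}z; have h w : inner (L w) y <= inner w p.
  have := vi (p + w) (- inner (L (p + w)) y) (lexx _).
  case: fp => <-; rewrite add0r (linearD L) innerDl (addrC p) addrK innerNl.
  rewrite (innerC p); lra.
by apply/eqP; rewrite eq_le h/=; have := h (- z); rewrite linearN !innerNl lerN2.
Qed.

End bounded_operators.

(** * Lagrange multipliers under the closed cone qualification *)

Lemma sqnorm_convex {R : realType} {H : hilbertType R} (t : R) (x y : H) :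
  0 <= t -> t <= 1 ->
  `|t *: x + (1 - t) *: y| ^+ 2 <= t * `|x| ^+ 2 + (1 - t) * `|y| ^+ 2.
Proof.
move=> t0 t1.
have t1' : 0 <= 1 - t by rewrite subr_ge0.
have := mulr_ge0 (mulr_ge0 t0 t1') (sqr_ge0 `|x - y|).
rewrite (sqnormB x) sqnormD innerZl innerZr !normrZ !exprMn (ger0_norm t0).
rewrite (ger0_norm t1'); lra.
Qed.

(** The assumption keeps [E] at a positive distance from [(0, s0)], so the two
    can be strictly separated.  The separating normal [(a, b)] is not
    horizontal because [E] has a point on the vertical axis; dividing by [b]
    gives the slope. *)
Lemma nonvertical_separation {R : realType} {K : hilbertType R}
    (E : set (hprod K R^o)) (s0 s1 delta e : R) :
  convex_subset E -> E (0, s1) -> 0 < delta -> 0 < e ->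
  (forall c, E c -> `|c.1| <= delta -> s0 + e <= c.2) ->
  exists p : K, forall c, E c -> s0 + inner p c.1 <= c.2.
Proof.
move=> cE E1 delta0 e0 Ege; pose d := Num.min (delta ^+ 2) (e ^+ 2).
have d0 : 0 < d by rewrite lt_min !exprn_gt0.
have [||[a b] ab] := @separation R (hprod K R^o) E (0, s0) d cE.
- by exists (0, s1).
- move=> c Ec; rewrite hprod_sqnorm /= subr0.
  have [c1|c1] := leP `|c.1| delta.
    apply: (@le_trans _ _ (e ^+ 2)); first by rewrite ge_min lexx orbT.
    rewrite -[leLHS]add0r lerD ?sqr_ge0// real_normK ?num_real//.
    have := Ege _ Ec c1 => h.
    by rewrite ler_pXn2r ?nnegrE//; lra.
  apply: (@le_trans _ _ (delta ^+ 2)); first by rewrite ge_min lexx.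
  rewrite -[leLHS]addr0 lerD ?sqr_ge0// ler_pXn2r ?nnegrE//; first exact: ltW.
  exact: ltW.
have abE c : E c -> d <= inner a c.1 + b * (c.2 - s0).
  by move=> /ab; rewrite hprod_innerE/= subr0.
have b0 : 0 < b.
  have s10 : 0 < s1 - s0 by have := Ege _ E1; rewrite /= normr0 => /(_ (ltW delta0)); lra.
  have := abE _ E1; rewrite /= inner0r add0r => h.
  by rewrite -(pmulr_lgt0 _ s10); exact: lt_le_trans h.
exists (- b^-1 *: a) => c /abE; rewrite innerZl => h.
rewrite -(ler_pM2l b0) mulrDr mulrA mulrN mulfV ?gt_eqF// mulN1r.
lra.
Qed.

Section multiplier.
Context {R : realType} {Z K : hilbertType R} (B : {linear Z -> K})
  (F : Z -> \bar R) (zb : Z) (m : R).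
Context (GF : Gamma0 F) (bB : bounded_near B (nbhs (0 : Z))) (Bzb : B zb = 0)
  (Fzb : (F zb <= m%:E)%E)
  (minF : forall z s, B z = 0 -> (F z <= s%:E)%E -> m <= s).

(** The epigraph of [F + |. - zb|^2 / 2].  The quadratic term keeps
    minimizing sequences bounded; being of second order at [zb] it does not
    change the multipliers. *)
Let regepi (z : Z) (v : R) :=
  exists2 s, (F z <= s%:E)%E & s + 2^-1 * `|zb - z| ^+ 2 <= v.

Let regepi_zb : regepi zb m.
Proof. by exists m => //; rewrite subrr normr0 expr0n mulr0 addr0. Qed.

Let regepi_convex x y (v w t : R) : 0 < t -> t < 1 -> regepi x v -> regepi y w ->
  regepi (t *: x + (1 - t) *: y) (t * v + (1 - t) * w).
Proof.
move=> t0 t1 [r Fr rv] [s Fs sw]; have [_ _ cF] := GF.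
exists (t * r + (1 - t) * s); first exact: econvex_le.
have -> : zb - (t *: x + (1 - t) *: y) = t *: (zb - x) + (1 - t) *: (zb - y).
  rewrite !scalerBr addrACA -opprD; congr (_ - _).
  by rewrite -scalerDl addrC subrK scale1r.
have := @sqnorm_convex _ _ t (zb - x) (zb - y) (ltW t0) (ltW t1).
have t1' : 0 < 1 - t by rewrite subr_gt0.
have : t * (r + 2^-1 * `|zb - x| ^+ 2) <= t * v by rewrite ler_pM2l.
have : (1 - t) * (s + 2^-1 * `|zb - y| ^+ 2) <= (1 - t) * w by rewrite ler_pM2l.
lra.
Qed.

(** Lower semicontinuity at the origin of the value function of the
    regularized problem: otherwise the minimization over the shrinking sets
    [|B z| <= 1 / (k + 1)] would produce a feasible point below the optimal
    value [m]. *)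
Let value_lsc (e : R) : 0 < e -> exists2 delta, 0 < delta &
  forall z v, regepi z v -> `|B z| <= delta -> m - e <= v.
Proof.
move=> e0; apply: contrapT => hn.
pose S k := [set z | `|B z| <= k.+1%:R^-1].
have [||k|z [zs [r [Szs zsz Fz zm _]]]] :=
  @sqnorm_reg_minimization R Z F zb S (m - e) GF.
- move=> k z; rewrite /S/= => /le_trans; apply.
  by rewrite lef_pV2 ?posrE// ler_nat.
- move=> k x y; rewrite /S /= => xk yk; rewrite linearZ linearD/= normrZ ger0_norm//.
  have := ler_normD (B x) (B y); move: (k.+1%:R^-1) xk yk => e'; lra.
- apply: contrapT => hk; apply: hn; exists k.+1%:R^-1; first by rewrite invr_gt0.
  move=> z v [s Fs sv] zk; rewrite leNgt; apply/negP => vm; apply: hk.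
  by exists z => //; exists s => //; apply: le_trans sv (ltW vm).
have Bz : B z = 0.
  apply/eqP; rewrite -normr_le0.
  apply: (cvgn_le (u := fun k => `|B (zs k)|) (v := fun k => k.+1%:R^-1)).
  - by apply: cvg_norm; exact: bounded_linear_cvg.
  - exact: cvg_harmonic.
  - exact: Szs.
have := minF Bz Fz; have := sqr_ge0 `|zb - z|; lra.
Qed.

Let approximate_multiplier (e : R) : 0 < e ->
  exists p, forall z v, regepi z v -> m - e + inner p (B z) <= v.
Proof.
move=> e0; have e20 : 0 < e / 2 by rewrite divr_gt0.
have [delta delta0 lsc] := value_lsc e20.
pose E : set (hprod K R^o) := [set c | exists2 z, c.1 = B z & regepi z c.2].
have [|||||p pP] := @nonvertical_separation _ _ E (m - e) m delta (e / 2).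
- move=> [c1 c2] [d1 d2] t t0 t1 [x /= -> xc] [y /= -> yd].
  have := regepi_convex t0 t1 xc yd => h.
  rewrite /E /=; exists (t *: x + (1 - t) *: y); last exact: h.
  by rewrite linearD !linearZ.
- by exists zb.
- exact: delta0.
- exact: e20.
- by move=> c [z -> zc] zd; have := lsc _ _ zc zd; lra.
by exists p => z v zv; apply: (pP (B z, v)); exists z.
Qed.

Context (clV : closed (cone [set B z | z in dom F]))
  (symV : forall v, cone [set B z | z in dom F] v ->
                    cone [set B z | z in dom F] (- v)).
Let V := cone [set B z | z in dom F].

Let VB z : dom F z -> V (B z).
Proof. by move=> Fz; exists 1, (B z); split; rewrite ?scale1r//; exists z. Qed.

Let V0 : V 0.
Proof. by rewrite -Bzb; apply: VB; apply: le_lt_trans Fzb _; rewrite ltry. Qed.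

Let VD v w : V v -> V w -> V (v + w).
Proof.
move=> [k [_ [k0 [x Fx <-] ->]]] [l [_ [l0 [y Fy <-] ->]]].
have kl0 : 0 < k + l by exact: addr_gt0.
have kl1 : 1 - k / (k + l) = l / (k + l) by field; rewrite gt_eqF.
exists (k + l), (B ((k / (k + l)) *: x + (1 - k / (k + l)) *: y)); split => //.
  exists ((k / (k + l)) *: x + (1 - k / (k + l)) *: y) => //.
  have [_ _ cF] := GF.
  apply: (@le_lt_trans _ _ ((k / (k + l)) * fine (F x) +
    (1 - k / (k + l)) * fine (F y))%:E); last by rewrite ltry.
  apply: econvex_le => //; try exact: Gamma0_dom.
    by rewrite divr_gt0.
  by rewrite ltr_pdivrMr// mul1r ltrDl.
rewrite kl1 linearD !linearZ/= scalerDr !scalerA.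
by congr (_ *: _ + _ *: _); field; rewrite gt_eqF.
Qed.

Let VZ (a : R) v : V v -> V (a *: v).
Proof.
have pos (b : R) w : 0 < b -> V w -> V (b *: w).
  move=> b0 [l [x [l0 Fx ->]]]; exists (b * l), x.
  by rewrite mulr_gt0// scalerA.
move=> Vv; have [a0|a0|->] := ltgtP a 0; last by rewrite scale0r.
  by rewrite -(opprK a) scaleNr; apply: symV; apply: pos; rewrite ?oppr_gt0.
exact: pos.
Qed.

(** This is where the qualification condition enters.  Approximate
    multipliers may be projected on the subspace [V]; they are then bounded at
    every point because every direction of [V] is feasible up to scaling, so
    the uniform boundedness principle makes them uniformly bounded. *)
Let exact_penalty : exists2 L, 0 < L &
  forall z v, regepi z v -> m <= v + L * `|B z|.
Proof.
have proj k : exists2 v, V v & forall w, V w -> inner k w = inner v w.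
  exact: orthogonal_projection.
have pn (n : nat) : exists p, V p /\
    forall z v, regepi z v -> m - n.+1%:R^-1 + inner p (B z) <= v.
  have [|p pP] := @approximate_multiplier n.+1%:R^-1; first by rewrite invr_gt0.
  have [q Vq qP] := proj p; exists q; split => // z v zv.
  rewrite -qP; first exact: pP.
  by apply: VB; case: zv => s Fs _; apply: le_lt_trans Fs _; rewrite ltry.
have {pn}[p pP] := choice pn.
(* Both [v] and [- v] are feasible directions, so an upper bound for every [k]
   bounds the values at [k] on both sides. *)
have ptop k : exists M, forall n, inner (p n) k <= M.
  have [v Vv vP] := proj k.
  have [l [_ [l0 [z Fz <-] vE]]] := Vv.
  have rz : regepi z (fine (F z) + 2^-1 * `|zb - z| ^+ 2).
    by exists (fine (F z)) => //; exact: Gamma0_dom.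
  set c := _ + _ in rz.
  exists (l * (c - m + 1)) => n; have [Vpn pnP] := pP n.
  rewrite innerC vP// vE innerZl ler_pM2l// innerC.
  have := pnP _ _ rz.
  have : n.+1%:R^-1 <= 1 :> R by rewrite invf_le1// ler1n.
  move: (n.+1%:R^-1) => e; lra.
have pbound : uniform_bounded [set f : K -> R^o | exists n, f = inner (p n)].
  apply: Banach_Steinhauss => [_ [n ->]|k].
    split; last by move=> a x y; rewrite innerDr innerZr.
    move=> r; exists (`|p n| * r) => x xr.
    by apply: le_trans (cauchy_schwarz_abs _ _) _; exact: ler_wpM2l.
  have [M1 M1P] := ptop k; have [M2 M2P] := ptop (- k).
  exists (Num.max M1 M2) => _ [n ->]; rewrite ler_norml lerNl -innerNr.
  by rewrite !le_max M1P M2P orbT.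
have [M MP] := pbound 1.
have pM n w : - inner (p n) w <= (`|M| + 1) * `|w|.
  have [->|w0] := eqVneq w 0; first by rewrite inner0r normr0 mulr0 oppr0.
  have nw : 0 < `|w| by rewrite normr_gt0.
  have := MP _ (ex_intro _ n erefl) (`|w|^-1 *: w).
  rewrite normrZ ger0_norm ?invr_ge0// mulVf ?gt_eqF// lexx => /(_ isT).
  rewrite innerZr => h; rewrite -ler_pdivrMr//.
  have := ler_norm M; have := lerNnormlW h; lra.
exists (`|M| + 1); first by rewrite ltr_pwDr.
move=> z v zv; apply: (cvgn_le (u := fun n => m - n.+1%:R^-1)
  (v := fun=> v + (`|M| + 1) * `|B z|)).
- rewrite -[m in _ --> m]subr0; apply: cvgB; [exact: cvg_cst|exact: cvg_harmonic].
- exact: cvg_cst.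
- move=> n; have := (pP n).2 _ _ zv; have := pM n (B z).
  move: (n.+1%:R^-1) => e; lra.
Qed.

(** Exact penalization says that the cone generated by the graph of the
    regularized problem, translated by [- m], avoids a neighbourhood of
    [(0, -1)]; a hyperplane separating the two supports that cone at the
    origin.  The regularization then disappears along segments ending at
    [zb], where it is of second order. *)
Lemma multiplier_exists :
  exists p, forall z s, (F z <= s%:E)%E -> m + inner p (B z) <= s.
Proof.
have [L L0 penalty] := exact_penalty.
pose E : set (hprod K R^o) := [set c | exists l z v,
  [/\ 0 < l, regepi z v, c.1 = l *: B z & c.2 = (l * (v - m) : R)]].
have Lz : 0 < (2 * L)^-1 by rewrite invr_gt0 mulr_gt0.
have [||||c|p pP] := @nonvertical_separation _ _ E (-1) 0 (2 * L)^-1 2^-1.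
- move=> [c1 c2] [d1 d2] t t0 t1.
  move=> [k [x [v [/= k0 xv -> ->]]]] [l [y [w [/= l0 yw -> ->]]]].
  have a0 : 0 < t * k by rewrite mulr_gt0.
  have b0 : 0 < (1 - t) * l by rewrite mulr_gt0// subr_gt0.
  set a := t * k in a0; set b := (1 - t) * l in b0.
  have ab0 : 0 < a + b by exact: addr_gt0.
  have abE : 1 - a / (a + b) = b / (a + b) by field; rewrite gt_eqF.
  have := @regepi_convex x y v w (a / (a + b)).
  rewrite divr_gt0// ltr_pdivrMr// mul1r ltrDl => /(_ isT b0 xv yw).
  rewrite abE => h.
  rewrite /E /=; do 3!eexists; split; [exact: ab0|exact: h| |].
    rewrite linearD !linearZ/= scalerDr !scalerA.
    by congr (_ *: _ + _ *: _); rewrite /a /b; field; rewrite gt_eqF.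
  have : t * (k * (v - m)) + (1 - t) * (l * (w - m)) =
      (a + b) * (a / (a + b) * v + b / (a + b) * w - m).
    by rewrite /a /b; field; rewrite gt_eqF.
  by [].
- exists 1, zb, m; split => //=; first by rewrite Bzb scaler0.
  by have : 0 = 1 * (m - m) by rewrite subrr mulr0.
- exact: Lz.
- by rewrite invr_gt0.
- move=> [l [z [v [l0 zv c1E c2E]]]]; rewrite c1E c2E normrZ gtr0_norm//.
  rewrite -[X in _ <= X]mul1r ler_pdivlMr ?mulr_gt0// => h.
  have := penalty _ _ zv; have : 0 <= `|B z| by [].
  nra.
(* Scaling the point of the cone by [t^-1] and letting [t] tend to [0]
   removes the offset [-1]. *)
have pR z v : regepi z v -> m + inner p (B z) <= v.
  move=> zv; rewrite -lerBrDl -subr_ge0.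
  apply: (@ge0_of_small_quadratic _ _ 1) => t t0 t1.
  have : -1 + inner p (t^-1 *: B z) <= t^-1 * (v - m).
    by apply: (pP (t^-1 *: B z, t^-1 * (v - m))); exists t^-1, z, v; rewrite invr_gt0.
  rewrite innerZr -(ler_pM2l (exprn_gt0 2 t0)).
  have -> : t ^+ 2 * (-1 + t^-1 * inner p (B z)) = - t ^+ 2 + t * inner p (B z).
    by field; rewrite gt_eqF.
  have -> : t ^+ 2 * (t^-1 * (v - m)) = t * (v - m) by field; rewrite gt_eqF.
  lra.
exists p => z s Fs.
suff : 0 <= s - m - inner p (B z) by lra.
apply: (@ge0_of_small_quadratic _ _ (2^-1 * `|zb - z| ^+ 2)) => t t0 t1.
have [_ _ cF] := GF.
have : regepi (t *: z + (1 - t) *: zb)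
    (t * s + (1 - t) * m + t ^+ 2 * (2^-1 * `|zb - z| ^+ 2)).
  exists (t * s + (1 - t) * m); first exact: econvex_le.
  rewrite (segmentE t z zb) opprD addrA subrr sub0r normrN normrZ exprMn gtr0_norm//.
  by rewrite (distrC z zb); lra.
move=> /pR; rewrite linearD !linearZ/= Bzb scaler0 addr0 innerZr; lra.
Qed.

End multiplier.

(** * Recursive inequalities and step sizes *)

Section recursive_inequalities.
Context {R : realType}.
Implicit Types (a b c d : nat -> R).

Lemma sum_shift (f : nat -> R) N k :
  \sum_(0 <= j < k) f (N + j)%N =
  \sum_(0 <= j < N + k) f j - \sum_(0 <= j < N) f j.
Proof.
rewrite (@big_cat_nat _ _ _ N 0 (N + k)) ?leq_addr//= addrAC subrr add0r.
rewrite -[X in _ = \sum_(X <= _ < _) _]add0n big_addn addKn.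
by apply: eq_bigr => j _; rewrite addnC.
Qed.

Lemma summable_tail d (A : R) : (forall n, 0 <= d n) ->
  (forall k, \sum_(0 <= j < k) d j <= A) -> forall e, 0 < e ->
  exists N, forall n k, (N <= n)%N -> \sum_(0 <= j < k) d (n + j)%N <= e.
Proof.
move=> d0 dA e e0; pose S k := \sum_(0 <= j < k) d j.
have Smono : nondecreasing_seq S.
  move=> m n mn; rewrite /S (@big_cat_nat _ _ _ m 0 n)//= lerDl.
  by apply: sumr_ge0.
have Sub : has_ubound (range S) by exists A => _ [k _ <-]; exact: dA.
have Scvg := nondecreasing_cvgn Smono Sub.
have [N _ NP] : \forall n \near \oo, sup (range S) - e < S n.
  by apply: (cvgr_gt _ Scvg); lra.
exists N => n k Nn; rewrite sum_shift.
have : S (n + k)%N <= sup (range S) by apply: ub_le_sup => //; exists (n + k)%N.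
by have := NP _ Nn; rewrite /S; lra.
Qed.

Definition tails_diverge b :=
  forall N A, exists k, A <= \sum_(0 <= j < k) b (N + j)%N.

Definition tails_vanish d := forall e, 0 < e ->
  exists N, forall n k, (N <= n)%N -> \sum_(0 <= j < k) d (n + j)%N <= e.

Definition limsup_nonpos c := forall e, 0 < e ->
  exists N, forall n, (N <= n)%N -> c n <= e.

(** Unfolding the recursion from a late index on, the initial value is
    multiplied by the product of the [1 - b j], which is at most
    [1 / (1 + \sum_j b j)] and so vanishes in the limit; the remaining terms
    are small in the tail. *)
Lemma recursive_inequality_cvg0 a b c d N0 :
  (forall n, 0 <= a n) ->
  (forall n, (N0 <= n)%N -> 0 <= b n /\ b n <= 1) ->
  (forall n, 0 <= d n) ->
  (forall n, (N0 <= n)%N -> a n.+1 <= (1 - b n) * a n + b n * c n + d n) ->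
  tails_diverge b -> limsup_nonpos c -> tails_vanish d ->
  a @ \oo --> (0 : R).
Proof.
move=> a0 b01 d0 rec bdiv csup dvan; apply/cvgrPdist_le => e e0.
have e3 : 0 < e / 3 by rewrite divr_gt0.
have [N1 cN1] := csup _ e3; have [N2 dN2] := dvan _ e3.
pose N := maxn N0 (maxn N1 N2).
have NN0 : (N0 <= N)%N by exact: leq_maxl.
have NN1 : (N1 <= N)%N by rewrite !leq_max leqnn orbT.
have N2N : (N2 <= N)%N by rewrite !leq_max leqnn !orbT.
have N0N k : (N0 <= N + k)%N by exact: leq_trans NN0 (leq_addr _ _).
have N1N k : (N1 <= N + k)%N by exact: leq_trans NN1 (leq_addr _ _).
pose B k := \sum_(0 <= j < k) b (N + j)%N.
pose D k := \sum_(0 <= j < k) d (N + j)%N.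
have B0 k : 0 <= B k by apply: sumr_ge0 => j _; have [] := b01 _ (N0N j).
have D0 k : 0 <= D k by apply: sumr_ge0.
have Bmono k l : (k <= l)%N -> B k <= B l.
  move=> kl; rewrite /B (@big_cat_nat _ _ _ k 0 l)//= lerDl.
  by apply: sumr_ge0 => j _; have [] := b01 _ (N0N j).
(* The bound is invariant because [(1 - b) / (1 + B) <= 1 / (1 + B + b)]. *)
have main k : a (N + k)%N <= e / 3 + D k + (1 + B k)^-1 * a N.
  elim: k => [|k IH].
    by rewrite addn0 /D /B !big_geq// !addr0 invr1 mul1r; have := a0 N; lra.
  have [b0 b1] := b01 _ (N0N k).
  rewrite addnS; apply: (le_trans (rec _ (N0N k))).
  rewrite {1}/D {1}/B !big_nat_recr//= -/(D k) -/(B k).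
  set bk := b _ in b0 b1 *; set dk := d _.
  have b1' : 0 <= 1 - bk by lra.
  have h1 := ler_wpM2l b1' IH.
  have h2 := ler_wpM2l b0 (cN1 _ (N1N k)).
  have h3 : (1 - bk) * (1 + B k)^-1 <= (1 + (B k + bk))^-1.
    have Bk := B0 k.
    rewrite ler_pdivrMr; last by lra.
    rewrite mulrC ler_pdivlMr; last by lra.
    nra.
  have h4 := ler_wpM2r (a0 N) h3; have := mulr_ge0 b0 (D0 k).
  move: h1 h2 h4; set P := (1 + B k)^-1; set Q := (1 + (B k + bk))^-1.
  nra.
have [K KP] := bdiv N ((a N) / (e / 3)).
exists (N + K)%N => // n /= Nn; rewrite sub0r normrN ger0_norm//.
have nE : n = (N + (n - N))%N by rewrite subnKC// (leq_trans _ Nn)// leq_addr.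
have Kn : (K <= n - N)%N by rewrite -(leq_add2l N) -nE.
rewrite nE; apply: (le_trans (main _)).
have := dN2 _ (n - N)%N N2N; rewrite -/(D _).
suff : (1 + B (n - N)%N)^-1 * a N <= e / 3 by lra.
have Bp : 0 < 1 + B (n - N)%N by have := B0 (n - N)%N; lra.
rewrite mulrC ler_pdivrMr// mulrC -ler_pdivrMr//.
by have := le_trans KP (Bmono _ _ Kn); lra.
Qed.

End recursive_inequalities.

Section step_sizes.
Context {R : realType}.
Implicit Types lam : nat -> R.

Lemma divergent_tails lam : (forall n, 0 <= lam n.+1) ->
  (\sum_(0 <= n <oo) (lam n.+1)%:E = +oo)%E -> tails_diverge (lam \o S).
Proof.
move=> l0 lsum N A; apply: contrapT => hn.
have bound k : \sum_(0 <= j < k) lam j.+1 <= A + \sum_(0 <= j < N) lam j.+1.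
  have Ak : \sum_(0 <= j < k) lam (N + j).+1 < A.
    by rewrite ltNge; apply/negP => Ak; apply: hn; exists k.
  apply: (@le_trans _ _ (\sum_(0 <= j < N + k) lam j.+1)).
    rewrite (@big_cat_nat _ _ _ k 0 (N + k)) ?leq_addl//= lerDl.
    exact: sumr_ge0.
  by have := @sum_shift _ (lam \o S) N k; rewrite /comp => h; lra.
suff : (\sum_(0 <= n <oo) (lam n.+1)%:E <=
    (A + \sum_(0 <= j < N) lam j.+1)%:E)%E by rewrite lsum leye_eq.
apply: lime_le; first by apply: is_cvg_nneseries => n _ _; rewrite lee_fin.
by apply: nearW => k; rewrite sumEFin lee_fin.
Qed.

(** What the two step size regimes have in common: relative to the step sizes
    themselves, their variation is negligible up to a summable error.  The
    variation is itself summable in the first regime, and [o(lam^2)] in the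
    second. *)
Lemma step_variation lam : stepsW lam \/ stepsL lam ->
  [/\ forall n, 0 <= lam n.+1, lam @ \oo --> (0 : R), tails_diverge (lam \o S) &
    exists c d : nat -> R, [/\ forall n, 0 <= d n,
      forall n, `|lam n.+1 - lam n.+2| <= lam n.+2 * c n + d n,
      limsup_nonpos c & tails_vanish d]].
Proof.
case=> [[l0 lcvg lsum lvar]|[l0 lcvg lsum lvar]].
  split => //; first exact: divergent_tails.
  exists (fun=> 0), (fun n => `|lam n.+1 - lam n.+2|); split => //.
  - by move=> n; rewrite mulr0 add0r.
  - by move=> e e0; exists 0%N => n _; exact: ltW.
  have vfin : (\sum_(0 <= n <oo) `|lam n.+1 - lam n.+2|%:E)%E \is a fin_num.
    by rewrite ge0_fin_numE//; apply: nneseries_ge0 => n _ _; rewrite lee_fin.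
  apply: (@summable_tail _ _ (fine (\sum_(0 <= n <oo) `|lam n.+1 - lam n.+2|%:E)%E)).
    by [].
  move=> k; rewrite -lee_fin fineK// -sumEFin.
  by apply: nneseries_lim_ge => n _ _; rewrite lee_fin.
have l0' n : 0 <= lam n.+1 by exact: ltW.
split => //; first exact: divergent_tails.
exists (fun n => `|lam n.+1 - lam n.+2| / lam n.+2), (fun=> 0); split => //.
- by move=> n; rewrite addr0 mulrC divfK// gt_eqF.
- move=> e e0.
  have [N1 _ N1P] : \forall n \near \oo, `|(lam n - lam n.+1) * lam n.+1 ^- 2| < 1.
    move/cvgr0Pnorm_lt : lvar => /(_ 1 ltr01); exact.
  have [N2 _ N2P] : \forall n \near \oo, lam n < e.
    exact: (cvgr_lt (0 : R) lcvg).
  exists (maxn N1 N2) => n; rewrite geq_max => /andP[nN1 nN2].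
  have := N1P n.+1 (leq_trans nN1 (leqnSn n)).
  have := N2P n.+2 (leq_trans nN2 (leq_trans (leqnSn n) (leqnSn n.+1))).
  have l2 := l0 n.+1; set l := lam n.+2 in l2 *; rewrite normrM.
  rewrite [X in _ * X]ger0_norm ?invr_ge0 ?exprn_ge0 ?(ltW l2)// => le_.
  rewrite ltr_pdivrMr ?exprn_gt0// mul1r => h.
  rewrite ler_pdivrMr//; nra.
- by move=> e e0; exists 0%N => n k _; rewrite big1// ltW.
Qed.

End step_sizes.

(** * The hybrid steepest descent method *)

Lemma cvgn_dist_le {R : realType} {H : hilbertType R} (u : nat -> H) (x : H)
    (e : nat -> R) :
  (forall n, `|u n - x| <= e n) -> e @ \oo --> (0 : R) -> u @ \oo --> x.
Proof.
move=> ue e0; apply/subr_cvg0; apply: norm_cvg0.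
apply: (@squeeze_cvgr _ _ _ _ (fun=> 0) e) => //; last exact: cvg_cst.
by apply: nearW => n; rewrite normr_ge0/=.
Qed.

Lemma cvgn_dist {R : realType} {H : hilbertType R} (u : nat -> H) (x : H) :
  u @ \oo --> x -> (fun n => `|u n - x|) @ \oo --> (0 : R).
Proof. by move=> ux; rewrite -(normr0 H); apply: cvg_norm; exact/subr_cvg0. Qed.

Lemma lipschitz_cvg {R : realType} {H G : hilbertType R} (f : H -> G) (k : R)
    (u : nat -> H) (x : H) :
  (forall x y, `|f x - f y| <= k * `|x - y|) -> u @ \oo --> x ->
  (f \o u) @ \oo --> f x.
Proof.
move=> fk ux; apply: (@cvgn_dist_le _ _ _ _ (fun n => k * `|u n - x|)) => [n|].
  exact: fk.
by rewrite -(mulr0 k); apply: cvgM; [exact: cvg_cst|exact: cvgn_dist].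
Qed.

Lemma limsup_nonpos_scale {R : realType} (k : R) (c : nat -> R) :
  0 <= k -> limsup_nonpos c -> limsup_nonpos (fun n => k * c n).
Proof.
move=> k0 cP e e0; have k1 : 0 < k + 1 by lra.
have [N NP] := cP _ (divr_gt0 e0 k1); exists N => n /NP h.
apply: (le_trans (ler_wpM2l k0 h)); rewrite mulrCA ler_piMr ?(ltW e0)//.
by rewrite ler_pdivrMr// mul1r lerDl.
Qed.

Lemma tails_vanish_scale {R : realType} (k : R) (d : nat -> R) :
  0 <= k -> tails_vanish d -> tails_vanish (fun n => k * d n).
Proof.
move=> k0 dP e e0; have k1 : 0 < k + 1 by lra.
have [N NP] := dP _ (divr_gt0 e0 k1); exists N => n j /NP h.
rewrite -mulr_sumr; apply: (le_trans (ler_wpM2l k0 (h j))).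
by rewrite mulrCA ler_piMr ?(ltW e0)// ler_pdivrMr// mul1r lerDl.
Qed.

Section hybrid_steepest_descent.
Context {R : realType} {H : hilbertType R} (T G : H -> H) (Theta : H -> R)
  (kappa eta : R).
Context (kappa0 : 0 < kappa) (eta0 : 0 < eta)
  (T1 : forall x y, `|T x - T y| <= `|x - y|)
  (Glip : forall x y, `|G x - G y| <= kappa * `|x - y|)
  (Gmon : forall x y, eta * `|x - y| ^+ 2 <= inner (G x - G y) (x - y))
  (ThetaG : forall x y, Theta x + inner (G x) (y - x) <= Theta y).
Implicit Types (x y z p : H) (lam : R).

Let lmax := Num.min (eta / kappa ^+ 2) eta^-1.

Let lmax0 : 0 < lmax.
Proof. by rewrite lt_min divr_gt0 ?exprn_gt0//= invr_gt0. Qed.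

(** Expanding the square bounds the squared factor by [1 - lam * eta] as long
    as [lam * kappa^2 <= eta]; the square root of this is at most
    [1 - lam * eta / 2]. *)
Let gradient_step_contracts lam x y : 0 <= lam -> lam <= lmax ->
  `|(x - lam *: G x) - (y - lam *: G y)| <= (1 - lam * (eta / 2)) * `|x - y|.
Proof.
move=> l0; rewrite le_min => /andP[l1 l2].
have le1 : lam * eta <= 1 by rewrite -ler_pdivlMr// mul1r.
have lk : lam * kappa ^+ 2 <= eta by rewrite -ler_pdivlMr ?exprn_gt0.
have c0 : 0 <= 1 - lam * (eta / 2) by have := mulr_ge0 l0 (ltW eta0); lra.
rewrite -(@ler_pXn2r _ 2)// ?nnegrE ?mulr_ge0// exprMn.
have -> : (x - lam *: G x) - (y - lam *: G y) = (x - y) - lam *: (G x - G y).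
  by rewrite scalerBr !opprB addrACA [RHS]addrACA; congr (_ + _); rewrite addrC.
rewrite sqnormB innerZr normrZ exprMn (ger0_norm l0) (innerC (x - y)).
have h1 := ler_wpM2l l0 (Gmon x y).
have h2 : `|G x - G y| ^+ 2 <= kappa ^+ 2 * `|x - y| ^+ 2.
  by rewrite -exprMn ler_pXn2r ?nnegrE// mulr_ge0// ltW.
have h3 := ler_wpM2l (sqr_ge0 lam) h2.
have h4 := ler_wpM2r (sqr_ge0 `|x - y|) (ler_wpM2l l0 lk).
have := mulr_ge0 (sqr_ge0 (lam * (eta / 2))) (sqr_ge0 `|x - y|).
move: (`|x - y| ^+ 2) h1 h3 h4 => D; move: (inner _ _) (`|G x - G y| ^+ 2) => I N.
lra.
Qed.

(** Strong convexity: chain the gradient inequalities from [x] to the midpoint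
    and from the midpoint to [y], and compare the two gradients. *)
Let Theta_strong x y :
  Theta x + inner (G x) (y - x) + eta / 4 * `|y - x| ^+ 2 <= Theta y.
Proof.
pose h := 2^-1 *: (y - x); pose z := x + h.
have zx : z - x = h by rewrite /z addrC addKr.
have yz : y - z = h.
  have -> : y - z = (y - x) - h by rewrite /z opprD addrA.
  by rewrite -{1}(scale1r (y - x)) -scalerBl; congr (_ *: _); field.
have := ThetaG x z; have := ThetaG z y; rewrite zx yz.
have := Gmon z x; rewrite zx innerDl innerNl.
have -> : inner (G x) (y - x) = 2 * inner (G x) h.
  by rewrite innerZr mulrA mulfV// mul1r.
have -> : `|y - x| ^+ 2 = 4 * `|h| ^+ 2.
  by rewrite normrZ exprMn ger0_norm//; field.
lra.
Qed.

(** With [g] chosen so that [(1 - g) * lmax = g * s], the equation is the fixed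
    point equation of a convex combination of [T] and a gradient step, hence of
    a contraction. *)
Let resolvent (s : R) : 0 < s -> exists z, z - T z = - (s *: G z).
Proof.
move=> s0.
have [g [g0 g1 gE]] : exists g, [/\ 0 < g, g < 1 & (1 - g) * lmax = g * s].
  have ls : 0 < lmax + s by exact: addr_gt0.
  exists (lmax / (lmax + s)); split; last by field; rewrite gt_eqF.
    by rewrite divr_gt0.
  by rewrite ltr_pdivrMr// mul1r ltrDl.
pose f z := g *: T z + (1 - g) *: (z - lmax *: G z).
pose q := g + (1 - g) * (1 - lmax * (eta / 2)).
have le1 : lmax * eta <= 1.
  by rewrite -ler_pdivlMr// mul1r ge_min lexx orbT.
have le0 : 0 < lmax * eta by exact: mulr_gt0.
have q0 : 0 <= q.
  apply: addr_ge0; first exact: ltW.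
  by apply: mulr_ge0; [rewrite subr_ge0 ltW|move: le1; lra].
have q1 : q < 1.
  have : 0 < (1 - g) * (lmax * eta) by rewrite mulr_gt0// subr_gt0.
  rewrite /q; lra.
have ctr : is_contraction (totalfun f).
  exists (NngNum q0); split => //= -[x y] _ /=.
  have -> : totalfun f x - totalfun f y = g *: (T x - T y) +
      (1 - g) *: ((x - lmax *: G x) - (y - lmax *: G y)).
    by rewrite /totalfun_ /f !scalerBr opprD addrACA.
  apply: (le_trans (ler_normD _ _)); rewrite !normrZ gtr0_norm//.
  rewrite gtr0_norm ?subr_gt0//.
  have h1 := ler_wpM2l (ltW g0) (T1 x y).
  have g1' : 0 <= 1 - g by rewrite subr_ge0 ltW.
  have h2 := ler_wpM2l g1' (gradient_step_contracts x y (ltW lmax0) (lexx _)).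
  rewrite /q; apply: (le_trans (lerD h1 h2)); rewrite le_eqVlt; apply/orP; left.
  apply/eqP; ring.
have [||z _ zE] := banach_fixed_point ctr.
- exact: closedT.
- by exists 0.
exists z; apply: (scalerI (lt0r_neq0 g0)).
have {}zE : z = g *: T z + (1 - g) *: (z - lmax *: G z) by exact: zE.
have gz : g *: z = g *: T z - (g * s) *: G z.
  apply: (addrI ((1 - g) *: z)); rewrite -scalerDl subrK scale1r {1}zE -gE.
  by rewrite scalerBr scalerA addrCA.
by rewrite scalerBr gz addrAC subrr sub0r scalerN scalerA.
Qed.

(** [I - T] is monotone because [T] is nonexpansive. *)
Let monotone_residual x y : 0 <= inner ((x - T x) - (y - T y)) (x - y).
Proof.
have -> : (x - T x) - (y - T y) = (x - y) - (T x - T y).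
  by rewrite !opprD !opprK addrACA.
rewrite innerDl innerNl inner_norm subr_ge0 expr2.
apply: (le_trans (cauchy_schwarz _ _)).
exact: ler_wpM2r.
Qed.

Let resolvent_near (s : R) z y : 0 < s -> z - T z = - (s *: G z) ->
  s * inner (G z) (z - y) <= `|y - T y| * `|z - y|.
Proof.
move=> s0 zE; have := monotone_residual z y.
rewrite zE innerDl !innerNl innerZl => h.
have := cauchy_schwarz (- (y - T y)) (z - y); rewrite normrN innerNl; lra.
Qed.

(** This makes the path Cauchy: [Theta] increases along it as the parameter
    decreases, and it is bounded by its values at fixed points of [T].
    Monotonicity of [I - T] at [x] and [z], combined with strong monotonicity of
    [G] and [r < s], gives [inner (G z) (z - x) <= 0]. *)
Let resolvent_dist (r s : R) x z : 0 < r -> r < s ->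
  x - T x = - (r *: G x) -> z - T z = - (s *: G z) ->
  eta / 4 * `|x - z| ^+ 2 <= Theta x - Theta z.
Proof.
move=> r0 rs xE zE; have := monotone_residual z x.
rewrite zE xE innerDl !innerNl !innerZl => h.
have := Gmon z x; rewrite innerDl innerNl => mon.
have := Theta_strong z x; rewrite -(opprB z x) innerNr normrN => th.
suff : inner (G z) (z - x) <= 0 by lra.
rewrite leNgt; apply/negP => a0.
have d0 := mulr_ge0 (ltW eta0) (sqr_ge0 `|z - x|).
have := ler_wpM2l (ltW r0) mon; have := mulr_ge0 (ltW r0) d0.
have := mulr_gt0 (_ : 0 < s - r) a0; rewrite subr_gt0 => /(_ rs).
lra.
Qed.

(** [z0] is the limit of Browder's path, formed by the solutions of
    [z - T z + s *: G z = 0], as [s] tends to [0].  The last clause, an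
    approximate variational inequality at approximate fixed points, takes the
    place of a weak compactness argument: it is the inequality
    [resolvent_near] at one point of the path close enough to [z0]. *)
Lemma steepest_descent_path p0 : T p0 = p0 -> exists z0, [/\ T z0 = z0,
  forall p, T p = p -> Theta z0 + eta / 4 * `|p - z0| ^+ 2 <= Theta p &
  forall e M : R, 0 < e -> exists2 C, 0 <= C & forall y, `|y - z0| <= M ->
    inner (G z0) (z0 - y) <= e + C * `|y - T y|].
Proof.
move=> Tp0.
have sn0 (n : nat) : 0 < n.+1%:R^-1 :> R by rewrite invr_gt0.
have [z zE] := choice (fun n => resolvent (sn0 n)).
have zVI n p : T p = p -> inner (G (z n)) (z n - p) <= 0.
  move=> Tp; have := resolvent_near p (sn0 n) (zE n).
  by rewrite Tp subrr normr0 mul0r pmulr_rle0.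
have Thetap n p : T p = p -> Theta (z n) <= Theta p.
  move=> Tp; have := ThetaG (z n) p; have := zVI n _ Tp.
  rewrite -(opprB (z n) p) innerNr; lra.
have dist j k : (k <= j)%N -> eta / 4 * `|z j - z k| ^+ 2 <= Theta (z j) - Theta (z k).
  rewrite leq_eqVlt => /orP[/eqP ->|kj].
    by rewrite !subrr normr0 expr0n mulr0.
  apply: (resolvent_dist (sn0 j) _ (zE j) (zE k)).
  by rewrite ltf_pV2 ?posrE// ltr_nat.
have Tmono : nondecreasing_seq (Theta \o z).
  move=> k j kj /=; have := dist _ _ kj.
  have := mulr_ge0 (ltW eta0) (sqr_ge0 `|z j - z k|); lra.
have Tub : has_ubound (range (Theta \o z)).
  by exists (Theta p0) => _ [k _ <-]; exact: Thetap.
have Tcvg := nondecreasing_cvgn Tmono Tub; set mu := sup _ in Tcvg.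
have [z0 zz0] : exists z0 : H, z @ \oo --> z0.
  apply: (@cvgn_of_sqdist _ _ z (fun k => (eta / 4)^-1 * (mu - Theta (z k)))).
    move=> j k kj; rewrite mulrC ler_pdivlMr ?divr_gt0// mulrC.
    apply: (le_trans (dist _ _ kj)); rewrite lerB//.
    by apply: ub_le_sup => //; exists j.
  rewrite -(mulr0 (eta / 4)^-1); apply: cvgM; first exact: cvg_cst.
  by rewrite -(subrr mu); apply: cvgB => //; exact: cvg_cst.
have T1' x y : `|T x - T y| <= 1 * `|x - y| by rewrite mul1r.
have GzG := lipschitz_cvg Glip zz0.
have TzT := lipschitz_cvg T1' zz0.
have Tz0 : T z0 = z0.
  have h1 : (fun n => z n - T (z n)) @ \oo --> z0 - T z0 by exact: cvgB.
  have h2 : (fun n => z n - T (z n)) @ \oo --> (0 : H).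
    under eq_fun do rewrite zE; rewrite -oppr0; apply: cvgN.
    rewrite -(scale0r (G z0)); apply: cvgZ => //; exact: cvg_harmonic.
  have z0T : z0 - T z0 = 0 := cvg_unique (@norm_hausdorff _ _) h1 h2.
  by apply/esym/eqP; rewrite -subr_eq0 z0T.
have VI0 p : T p = p -> inner (G z0) (z0 - p) <= 0.
  move=> Tp; apply: (cvgn_le (u := fun n => inner (G (z n)) (z n - p))
    (v := fun=> 0)) => [||n]; last exact: zVI.
    by apply: cvg_inner => //; apply: cvgB => //; exact: cvg_cst.
  exact: cvg_cst.
exists z0; split => //.
  move=> p Tp; have := Theta_strong z0 p; have := VI0 _ Tp.
  rewrite -(opprB p z0) innerNr; lra.
move=> e M e0.
pose err n := `|G z0 - G (z n)| * `|M| + `|G (z n)| * `|z n - z0|.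
have err0 : err @ \oo --> (0 : R).
  have -> : 0 = 0 * `|M| + `|G z0| * 0 :> R by rewrite mul0r mulr0 addr0.
  apply: cvgD; apply: cvgM.
  - under eq_fun do rewrite distrC; exact: (cvgn_dist GzG).
  - exact: cvg_cst.
  - exact: (cvg_norm GzG).
  - exact: (cvgn_dist zz0).
have [n errn] : exists n, err n < e.
  by have [N _ NP] := cvgr_lt (0 : R) err0 _ e0; exists N; exact: (NP N (leqnn N)).
exists (n.+1%:R * (`|z n - z0| + `|M|)); first by rewrite mulr_ge0// addr_ge0.
move=> y yM.
have yM' : `|z0 - y| <= `|M| by rewrite distrC (le_trans yM)// ler_norm.
have -> : inner (G z0) (z0 - y) = inner (G z0 - G (z n)) (z0 - y)
    + inner (G (z n)) (z0 - z n) + inner (G (z n)) (z n - y).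
  by rewrite !innerE; ring.
have h1 := le_trans (cauchy_schwarz (G z0 - G (z n)) (z0 - y))
  (ler_wpM2l (normr_ge0 _) yM').
have h2 := cauchy_schwarz (G (z n)) (z0 - z n); rewrite distrC in h2.
suff h3 : inner (G (z n)) (z n - y) <= n.+1%:R * (`|z n - z0| + `|M|) * `|y - T y|.
  have : err n < e by []; rewrite /err; lra.
have := resolvent_near y (sn0 n) (zE n).
rewrite mulrC ler_pdivrMr// => h; apply: (le_trans h).
rewrite -mulrA mulrC ler_wpM2l// mulrC ler_wpM2r//.
apply: le_trans (_ : `|z n - z0| + `|z0 - y| <= _); last by rewrite lerD2l.
by rewrite -[z n - y](subrKA z0) ler_normD.
Qed.

(** Strong convergence of the hybrid steepest descent method.  Boundedness and
    asymptotic regularity come from the contraction property of the gradient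
    steps; then the squared distances to [z0] satisfy a recursive inequality
    whose error term is, up to a factor, [inner (G z0) (z0 - z n)], and this
    has a nonpositive upper limit because the iterates are approximate fixed
    points. *)
Lemma hybrid_steepest_descent_cvg (lam : nat -> R) (z : nat -> H) z0 :
  T z0 = z0 ->
  (forall e M : R, 0 < e -> exists2 C, 0 <= C & forall y, `|y - z0| <= M ->
    inner (G z0) (z0 - y) <= e + C * `|y - T y|) ->
  stepsW lam \/ stepsL lam ->
  (forall n, z n.+1 = T (z n) - lam n.+1 *: G (T (z n))) ->
  z @ \oo --> z0.
Proof.
move=> Tz0 approx /step_variation[l0 lcvg ldiv [c [d [d0 lvar csup dvan]]]] zS.
pose tau := eta / 2; have tau0 : 0 < tau by rewrite divr_gt0.
have [N0 lN0] : exists N, forall n, (N <= n)%N -> lam n <= lmax.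
  have [N _ NP] := cvgr_lt (0 : R) lcvg _ lmax0.
  by exists N => n /NP/ltW.
have ltau n : (N0 <= n)%N -> 0 <= lam n.+1 * tau /\ lam n.+1 * tau <= 1.
  move=> Nn; split; first by rewrite mulr_ge0// ltW.
  have : lam n.+1 <= eta^-1.
    by have := lN0 n.+1 (leqW Nn); rewrite le_min => /andP[].
  rewrite -[eta^-1]mul1r ler_pdivlMr// /tau.
  by have := mulr_ge0 (l0 n) (ltW eta0); lra.
have step n x y : (N0 <= n)%N -> `|(T x - lam n.+1 *: G (T x)) -
    (T y - lam n.+1 *: G (T y))| <= (1 - lam n.+1 * tau) * `|x - y|.
  move=> Nn; apply: (le_trans (gradient_step_contracts _ _ (l0 n) (lN0 _ (leqW Nn)))).
  by apply: ler_wpM2l => //; have [] := ltau _ Nn; rewrite subr_ge0.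
have fixed n : z n.+1 - z0 = ((T (z n) - lam n.+1 *: G (T (z n))) -
    (T z0 - lam n.+1 *: G (T z0))) - lam n.+1 *: G z0.
  by rewrite zS Tz0 opprB [in RHS]addrA [RHS]addrAC addrK.
(* If [|z n - z0| <= M], the fixed point [z0] is moved by at most
   [lam * |G z0|] in each step, which the contraction absorbs as soon as
   [|G z0| <= tau * M]. *)
have [M zM] : exists M, forall n, (N0 <= n)%N -> `|z n - z0| <= M.
  exists (Num.max `|z N0 - z0| (`|G z0| / tau)) => n.
  elim: n => [|n IH]; first by rewrite leqn0 => /eqP ->; rewrite le_max lexx.
  rewrite leq_eqVlt => /orP[/eqP <-|]; first by rewrite le_max lexx.
  rewrite ltnS => Nn; set M := Num.max _ _ in IH *.
  have [lt0 lt1] := ltau _ Nn; have lt1' : 0 <= 1 - lam n.+1 * tau by lra.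
  rewrite fixed; apply: (le_trans (ler_normB _ _)).
  have h1 := le_trans (step n (z n) z0 Nn) (ler_wpM2l lt1' (IH Nn)).
  have h2 : `|G z0| <= tau * M.
    by rewrite mulrC -ler_pdivrMr// /M le_max lexx orbT.
  have h3 := ler_wpM2l (l0 n) h2.
  rewrite normrZ ger0_norm//; lra.
have [B B0 zB'] : exists2 B, 0 <= B & forall n, (N0 <= n)%N -> `|G (T (z n))| <= B.
  exists (`|G z0| + kappa * `|M|) => [|n Nn].
    by rewrite addr_ge0// mulr_ge0// ltW.
  have -> : G (T (z n)) = G z0 + (G (T (z n)) - G z0) by rewrite addrC subrK.
  apply: (le_trans (ler_normD _ _)); rewrite lerD2l.
  apply: (le_trans (Glip _ _)); rewrite ler_pM2l// -{1}Tz0.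
  apply: (le_trans (T1 _ _)); exact: le_trans (zM _ Nn) (ler_norm _).
have lam2div : tails_diverge (fun n => lam n.+2 * tau).
  move=> N A; have [k kA] := ldiv N.+1 (A / tau); exists k.
  by rewrite -mulr_suml -ler_pdivrMr.
have lam1div : tails_diverge (fun n => lam n.+1 * tau).
  move=> N A; have [k kA] := ldiv N (A / tau); exists k.
  by rewrite -mulr_suml -ler_pdivrMr.
(* Consecutive differences are contracted up to the variation of the step
   sizes, which is negligible by [step_variation]. *)
have reg : (fun n => `|z n.+1 - z n|) @ \oo --> (0 : R).
  apply: (@recursive_inequality_cvg0 _ _ (fun n => lam n.+2 * tau)
    (fun n => B / tau * c n) (fun n => B * d n) N0) => //.
  - by move=> n Nn; exact: ltau (leqW Nn).
  - by move=> n; exact: mulr_ge0.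
  - move=> n Nn.
    have -> : z n.+2 - z n.+1 =
        ((T (z n.+1) - lam n.+2 *: G (T (z n.+1))) -
         (T (z n) - lam n.+2 *: G (T (z n)))) +
        (lam n.+1 - lam n.+2) *: G (T (z n)).
      rewrite zS [X in _ - X = _](zS n) scalerBl -[RHS]addrA; congr (_ + _).
      by rewrite !opprB [RHS]addrC addrA subrK.
    apply: (le_trans (ler_normD _ _)); rewrite normrZ.
    have h1 := step n.+1 (z n.+1) (z n) (leqW Nn).
    have h2 := ler_pM (normr_ge0 _) (normr_ge0 _) (lvar n) (zB' _ Nn).
    have -> : lam n.+2 * tau * (B / tau * c n) = lam n.+2 * c n * B.
      by field; rewrite gt_eqF.
    lra.
  - by apply: limsup_nonpos_scale => //; rewrite divr_ge0// ltW.
  - exact: tails_vanish_scale.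
have res e : 0 < e -> exists N, forall n, (N <= n)%N -> `|z n - T (z n)| <= e.
  move=> e0.
  have cv : (fun n => `|z n.+1 - z n| + lam n.+1 * B) @ \oo --> (0 : R).
    have -> : 0 = 0 + 0 * B :> R by rewrite mul0r addr0.
    apply: cvgD => //; apply: cvgM; last exact: cvg_cst.
    by rewrite cvg_shiftS.
  have [N _ NP] := cvgr_lt (0 : R) cv _ e0.
  exists (maxn N0 N) => n; rewrite geq_max => /andP[N0n Nn].
  have -> : z n - T (z n) = - (z n.+1 - z n) - lam n.+1 *: G (T (z n)).
    by rewrite zS !opprB [in RHS]addrA [RHS]addrAC addrK.
  apply: le_trans (ltW (NP _ Nn)); apply: (le_trans (ler_normB _ _)).
  by rewrite normrN lerD2l normrZ ger0_norm// ler_wpM2l// zB'.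
have sq0 : (fun n => `|z n - z0| ^+ 2) @ \oo --> (0 : R).
  apply: (@recursive_inequality_cvg0 _ _ (fun n => lam n.+1 * tau)
    (fun n => 2 / tau * inner (G z0) (z0 - z n.+1)) (fun=> 0) N0) => //.
  - move=> n Nn; have [b0 b1] := ltau _ Nn; rewrite addr0.
    have -> : lam n.+1 * tau * (2 / tau * inner (G z0) (z0 - z n.+1)) =
        2 * lam n.+1 * inner (G z0) (z0 - z n.+1).
      by field; rewrite gt_eqF.
    have := step n (z n) z0 Nn; have := fixed n; set D := _ - _ - (_ - _) => E hD.
    have {E}DE : D = (z n.+1 - z0) + lam n.+1 *: G z0 by rewrite E subrK.
    have : `|D| ^+ 2 <= (1 - lam n.+1 * tau) * `|z n - z0| ^+ 2.
      apply: (@le_trans _ _ ((1 - lam n.+1 * tau) ^+ 2 * `|z n - z0| ^+ 2)).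
        by rewrite -exprMn ler_pXn2r ?nnegrE// mulr_ge0// subr_ge0.
      rewrite ler_wpM2r// expr2 ler_piMr ?subr_ge0//; lra.
    rewrite DE sqnormD innerZr -(opprB (z n.+1)) innerNr (innerC (G z0)).
    have := sqr_ge0 `|lam n.+1 *: G z0|; lra.
  - move=> e e0; have e0' : 0 < e * tau / 4 by rewrite divr_gt0// mulr_gt0.
    have [C C0 CP] := approx _ M e0'.
    have e1 : 0 < e * tau / 4 / (C + 1) by rewrite divr_gt0// ltr_wpDl.
    have [N NP] := res _ e1; exists (maxn N0 N) => n; rewrite geq_max => /andP[N0n Nn].
    have h1 := CP _ (zM _ (leqW N0n)).
    have h2 : C * `|z n.+1 - T (z n.+1)| <= e * tau / 4.
      apply: (@le_trans _ _ ((C + 1) * `|z n.+1 - T (z n.+1)|)).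
        by rewrite ler_wpM2r// lerDl.
      by rewrite mulrC -ler_pdivlMr ?ltr_wpDl//; exact: NP (leqW Nn).
    rewrite mulrAC ler_pdivrMr//; lra.
  - by move=> e e0; exists 0%N => n k _; rewrite big1// ltW.
apply/cvgrPdist_lt => e e0.
have [N _ NP] := cvgr_lt (0 : R) sq0 _ (exprn_gt0 2 e0).
exists N => // n /NP; rewrite /= distrC.
by rewrite ltr_pXn2r// nnegrE// ltW.
Qed.

End hybrid_steepest_descent.

(** * Fixed points of the augmented Lagrangian operator *)

Section sum_epigraph.
Context {R : realType}.

Lemma adde_le_fin (a b : \bar R) (r : R) : a != -oo%E -> b != -oo%E ->
  (a + b <= r%:E)%E ->
  exists a' b', [/\ (a <= a'%:E)%E, (b <= b'%:E)%E & a' + b' <= r].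
Proof.
case: a b => [a| |] [b| |]//= _ _; rewrite ?leye_eq//.
by rewrite -EFinD lee_fin => ab; exists a, b; rewrite !lexx.
Qed.

Lemma econvex_epi {H : hilbertType R} (f : H -> \bar R) :
  (forall x, f x != -oo%E) ->
  (forall x y r s t, 0 < t -> t < 1 -> (f x <= r%:E)%E -> (f y <= s%:E)%E ->
    (f (t *: x + (1 - t) *: y)%R <= (t * r + (1 - t) * s)%:E)%E) ->
  econvex f.
Proof.
move=> nf cf x y t t0 t1.
have t1' : 0 < 1 - t by rewrite subr_gt0.
case fx : (f x) => [r| |]; last by have := nf x; rewrite fx.
  case fy : (f y) => [s| |]; last by have := nf y; rewrite fy.
    by rewrite -!EFinM -EFinD; apply: cf; rewrite ?fx ?fy.
  by rewrite gt0_muley ?lte_fin// addey// leey.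
case fy : (f y) => [s| |]; last by have := nf y; rewrite fy.
  by rewrite gt0_muley ?lte_fin// addye// leey.
by rewrite !gt0_muley ?lte_fin// addye// leey.
Qed.

Context {X Y : hilbertType R} (f : X -> \bar R) (g : Y -> \bar R).

Definition fsum (z : hprod X Y) : \bar R := (f z.1 + g z.2)%E.

Lemma fsum_le z r : (forall x, f x != -oo%E) -> (forall y, g y != -oo%E) ->
  (fsum z <= r%:E)%E <->
  exists a b, [/\ (f z.1 <= a%:E)%E, (g z.2 <= b%:E)%E & a + b <= r].
Proof.
move=> nf ng; split; first exact: adde_le_fin.
move=> [a [b [fa gb abr]]]; apply: (le_trans (leeD fa gb)).
by rewrite -EFinD lee_fin.
Qed.

Lemma fsum_Gamma0 : Gamma0 f -> Gamma0 g -> Gamma0 fsum.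
Proof.
move=> [[nf [x0 fx0]] lf cf] [[ng [y0 gy0]] lg cg].
have ns z : fsum z != -oo%E by rewrite adde_eq_ninfty negb_or nf ng.
split.
- by split => //; exists (x0, y0); rewrite /dom/= lte_add_pinfty.
- move=> [x y] a; rewrite /fsum/= => afg.
  have [a1 [a2 [af ag aa]]] : exists a1 a2,
      [/\ (a1%:E < f x)%E, (a2%:E < g y)%E & a <= a1 + a2].
    have := nf x; have := ng y; move: afg.
    case: (f x) => [r| |]//; case: (g y) => [s| |]// + _ _.
    - rewrite -EFinD lte_fin => ars.
      exists (r - (r + s - a) / 2), (s - (r + s - a) / 2); rewrite !lte_fin.
      by split; lra.
    - move=> _; exists (r - 1), (a - (r - 1)); rewrite lte_fin ltry.
      by split => //; lra.
    - move=> _; exists (a - (s - 1)), (s - 1); rewrite lte_fin ltry.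
      by split => //; lra.
    - by move=> _; exists a, 0; rewrite !ltry; split => //; rewrite addr0.
  have [V1 /nbhs_normP[d1 /= d10 dV1] Vf] := lf _ _ af.
  have [V2 /nbhs_normP[d2 /= d20 dV2] Vg] := lg _ _ ag.
  exists [set z | V1 z.1 /\ V2 z.2].
    apply/nbhs_normP; exists (Num.min d1 d2); first by rewrite /= lt_min d10.
    move=> z /=; rewrite lt_min => /andP[zd1 zd2]; split.
      by apply: dV1; apply: le_lt_trans zd1; exact: (hprod_norm_fst ((x, y) - z)).
    by apply: dV2; apply: le_lt_trans zd2; exact: (hprod_norm_snd ((x, y) - z)).
  move=> z [/Vf fz /Vg gz]; apply: (@le_lt_trans _ _ (a1 + a2)%:E).
    by rewrite lee_fin.
  by rewrite EFinD; exact: lteD.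
- apply: econvex_epi => // z w r s t t0 t1.
  move=> /fsum_le-/(_ nf ng)[a [b [fa gb abr]]].
  move=> /fsum_le-/(_ nf ng)[c [d [fc gd cds]]].
  apply/fsum_le => //; exists (t * a + (1 - t) * c), (t * b + (1 - t) * d).
  split; [exact: econvex_le|exact: econvex_le|].
  have t1' : 0 <= 1 - t by rewrite subr_ge0 ltW.
  have := ler_wpM2l (ltW t0) abr; have := ler_wpM2l t1' cds; lra.
Qed.

End sum_epigraph.

Section prox_firm.
Context {R : realType} {H : hilbertType R}.

Lemma prox_firmly_nonexpansive (f : H -> \bar R) (v w : H) : Gamma0 f ->
  `|prox f v - prox f w| ^+ 2 <= inner (v - w) (prox f v - prox f w).
Proof.
move=> Gf; have [r [fv vi]] := proxP v Gf; have [s [fw wi]] := proxP w Gf.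
have := vi (prox f w) s; rewrite fw lexx => /(_ isT).
have := wi (prox f v) r; rewrite fv lexx => /(_ isT).
set p := prox f v; set q := prox f w.
rewrite -inner_norm !innerE (innerC q p); lra.
Qed.

End prox_firm.

Section constraint_defect.
Context {R : realType} {X K : hilbertType R} (A : {linear X -> K}).

Definition defect (z : hprod X K) : K := z.2 - A z.1.

Let defect_linear : linear defect.
Proof.
move=> a z w; rewrite /defect /= linearP/= scalerBr opprD addrACA.
by rewrite -addrA addrA.
Qed.

HB.instance Definition _ :=
  GRing.isLinear.Build R (hprod X K) K *:%R defect defect_linear.

Lemma defect_bounded : bounded_near A (nbhs (0 : X)) ->
  bounded_near defect (nbhs (0 : hprod X K)).
Proof.
move=> /bounded_linearP[b b0 bA].
have -> : defect = (defect : {linear hprod X K -> K}) :> (_ -> _) by [].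
apply/linear_boundedP; near=> r => z.
apply: (le_trans (ler_normB _ _)).
apply: (@le_trans _ _ ((1 + b) * `|z|)); last by rewrite ler_wpM2r//.
rewrite mulrDl mul1r lerD//; first exact: hprod_norm_snd.
apply: (le_trans (bA _)); rewrite ler_pM2l//; exact: hprod_norm_fst.
Unshelve. all: by end_near. Qed.

End constraint_defect.

Section fixed_points.
Context {R : realType} {X K : hilbertType R} (f : X -> \bar R)
  (g : K -> \bar R) (A : {linear X -> K}) (u : R).
Context (Gf : Gamma0 f) (Gg : Gamma0 g) (bA : bounded_near A (nbhs (0 : X)))
  (u0 : 0 < u).
Let Sp := argmin (fun x => (f x + g (A x))%E) [set: X].
Let T := TLAL A f g u.

(** [- u *: nu] is a Lagrange multiplier for the problem of minimizing
    [f x + g y] subject to [y = A x], whose optimal value is at least [m]. *)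
Definition saddle m nu := forall x y r s, (f x <= r%:E)%E -> (g y <= s%:E)%E ->
  m - u * inner nu (y - A x) <= r + s.

(** At a fixed point the proximal variational inequalities say that
    [u *: A^* nu] and [- u *: nu] are subgradients of [f] and [g]; adding them
    gives the saddle inequality. *)
Lemma TLAL_fixed x y nu : T (x, y, nu) = (x, y, nu) ->
  [/\ y = A x, Sp x & exists r s, [/\ f x = r%:E, g y = s%:E & saddle (r + s) nu]].
Proof.
move=> [xT yT nuT].
have yE : y = A x.
  move/eqP: nuT; rewrite xT yT -subr_eq0 addrAC subrr sub0r oppr_eq0.
  by rewrite scaler_eq0 gt_eqF//= subr_eq0 => /eqP.
have [r [fx fvi]] := proxP (x - u ^+ 2 *: (adjoint A (A x) - adjoint A y)
  + u *: adjoint A nu) Gf.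
have [s [gy gvi]] := proxP (y - u ^+ 2 *: (- A x + y) - u *: nu) Gg.
rewrite xT in fx fvi; rewrite yT in gy gvi.
have sad : saddle (r + s) nu.
  move=> x' y' r' s' /fvi h1 /gvi h2.
  move: h1 h2; rewrite yE subrr scaler0 subr0 addNr scaler0 subr0.
  rewrite [_ - x]addrAC subrr add0r [A x - _ - A x]addrAC subrr sub0r.
  rewrite innerZl (innerC _ (x' - x)) -adjointP// innerNl innerZl.
  by rewrite linearB/= !innerE (innerC (A x')) (innerC (A x)); lra.
split => //; last by exists r, s.
split => // x' _; rewrite fx -yE gy -EFinD.
have nf x0 : f x0 != -oo%E by have [[]] := Gf.
have ng y0 : g y0 != -oo%E by have [[]] := Gg.
case E : (f x' + g (A x'))%E => [c| |]; last 1 first.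
- by move/eqP : E; rewrite adde_eq_ninfty (negbTE (nf _)) (negbTE (ng _)).
- have [|a [b [fa gb abc]]] := @adde_le_fin _ (f x') (g (A x')) c (nf _) (ng _).
    by rewrite E.
  rewrite lee_fin; have := sad _ _ _ _ fa gb.
  by rewrite subrr inner0r mulr0 subr0 => h; exact: le_trans abc.
- exact: leey.
Qed.

(** Conversely, putting [y = A x], respectively the given [x], into the saddle
    inequality separates it into the two proximal variational inequalities. *)
Lemma fixed_TLAL x r s nu : f x = r%:E -> g (A x) = s%:E ->
  saddle (r + s) nu -> T (x, A x, nu) = (x, A x, nu).
Proof.
move=> fx gAx sad; rewrite /T /TLAL.
have -> : prox f (x - u ^+ 2 *: (adjoint A (A x) - adjoint A (A x)) +
    u *: adjoint A nu) = x.
  apply: (prox_unique fx) => x' r' fx'.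
  have := sad _ _ _ _ fx' (_ : (g (A x) <= s%:E)%E); rewrite gAx lexx => /(_ isT).
  rewrite subrr scaler0 subr0 [x + _]addrC addrK innerZl.
  rewrite (innerC _ (x' - x)) -adjointP// linearB/= !innerE.
  by rewrite (innerC nu) (innerC nu); lra.
have -> : prox g (A x - u ^+ 2 *: (- A x + A x) - u *: nu) = A x.
  apply: (prox_unique gAx) => y' s' gy'.
  have := sad _ _ _ _ (_ : (f x <= r%:E)%E) gy'; rewrite fx lexx => /(_ isT).
  rewrite addNr scaler0 subr0 [A x - _ - A x]addrAC subrr sub0r innerNl innerZl.
  rewrite !innerE; lra.
by rewrite subrr scaler0 subr0.
Qed.

Lemma Sp_fin : (dom g `&` A @` dom f) !=set0 -> forall x, Sp x ->
  exists r s, f x = r%:E /\ g (A x) = s%:E.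
Proof.
move=> [y0 [gy0 [x0 fx0 xy]]] x [_ /(_ x0 Logic.I) xmin]; rewrite -xy in gy0.
have : (f x + g (A x) < +oo)%E.
  by apply: le_lt_trans xmin _; rewrite lte_add_pinfty.
have nf : f x != -oo%E by have [[]] := Gf.
have ng : g (A x) != -oo%E by have [[]] := Gg.
case: (f x) nf => [r| |]//; case: (g (A x)) ng => [s| |]// _ _ _.
by exists r, s.
Qed.

End fixed_points.

(** * Strong duality and nonexpansiveness of the augmented Lagrangian operator *)

Lemma closure_opp {R : realType} {H : hilbertType R} (S : set H) (v : H) :
  (forall w, S w -> S (- w)) -> closure S v -> closure S (- v).
Proof.
move=> SN Sv U Uv; have [|w [Sw Uw]] := Sv (fun w => U (- w)).
  have vv : -%R @ v --> - v by exact: opp_continuous.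
  exact: (vv U Uv).
by exists (- w); split => //; exact: SN.
Qed.

Lemma lspan_opp {R : realType} {H : hilbertType R} (S : set H) (v : H) :
  lspan S v -> lspan S (- v).
Proof.
move=> [n [c [s [Ss ->]]]]; exists n, (fun i => - c i), s; split => //.
by rewrite -sumrN; apply: eq_bigr => i _; rewrite scaleNr.
Qed.

Section LAL_operator.
Context {R : realType} {X K : hilbertType R} (f : X -> \bar R)
  (g : K -> \bar R) (A : {linear X -> K}) (u : R).
Context (Gf : Gamma0 f) (Gg : Gamma0 g) (bA : bounded_near A (nbhs (0 : X)))
  (u0 : 0 < u).
Let Sp := argmin (fun x => (f x + g (A x))%E) [set: X].

(** The relative interior condition makes the cone of feasible perturbations
    the closure of a linear span: closed and symmetric, as
    [multiplier_exists] requires. *)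
Lemma saddle_exists x r s :
  sri [set y - A x | y in dom g & x in dom f] 0 ->
  Sp x -> f x = r%:E -> g (A x) = s%:E -> exists nu, saddle f g A u (r + s) nu.
Proof.
move=> [_ coneE] [_ xmin] fx gAx.
have nf x0 : f x0 != -oo%E by have [[]] := Gf.
have ng y0 : g y0 != -oo%E by have [[]] := Gg.
have DE : [set defect A z | z in dom (fsum f g)] =
    [set c - 0 | c in [set y - A x | y in dom g & x in dom f]].
  apply/seteqP; split => v.
    move=> [[a b] /= fgab <-]; exists (defect A (a, b)); last by rewrite subr0.
    have {fgab} : (f a + g b < +oo)%E by [].
    move=> fgab; exists b; last exists a => //.
      by rewrite /dom/= ltey; apply/eqP => E; rewrite E addey in fgab.
    by rewrite /dom/= ltey; apply/eqP => E; rewrite E addye in fgab.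
  move=> [_ [b gb [a fa <-]] <-]; rewrite subr0; exists (a, b) => //.
  exact: lte_add_pinfty.
rewrite -DE in coneE.
have [|||||||p pP] := @multiplier_exists _ _ _ (defect A) (fsum f g) (x, A x) (r + s).
- exact: fsum_Gamma0.
- exact: defect_bounded.
- exact: subrr.
- by rewrite /fsum/= fx gAx.
- move=> [a b] q ab h; have bE : b = A a by apply/eqP; rewrite -subr_eq0; apply/eqP.
  rewrite -lee_fin EFinD -fx -gAx; apply: le_trans h.
  by rewrite bE; exact: (xmin a Logic.I).
- by rewrite coneE; exact: closed_closure.
- move=> v; rewrite coneE; apply: closure_opp; exact: lspan_opp.
exists (- u^-1 *: p) => a b q t fa gb.
rewrite innerZl mulrA mulrN mulfV ?gt_eqF// mulN1r opprK.
by apply: (pP (a, b)); apply/fsum_le => //; exists q, t.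
Qed.

Context (nA : (opnorm (Acheck A) <= (u^-1)%:E)%E).

Lemma Acheck_bound (x : X) (y : K) :
  u ^+ 2 * `|A x - y| ^+ 2 <= `|x| ^+ 2 + `|y| ^+ 2.
Proof.
pose z : hprod X K := (x, y).
have -> : `|x| ^+ 2 + `|y| ^+ 2 = `|z| ^+ 2 by rewrite hprod_sqnorm.
rewrite -exprMn -[A x - y]/(Acheck A z).
rewrite ler_pXn2r ?nnegrE ?mulr_ge0// ?(ltW u0)//.
have [z0|z0] := eqVneq z 0.
  by rewrite z0 /Acheck/= linear0 subrr !normr0 mulr0.
have nz : 0 < `|z| by rewrite normr_gt0.
have : (`|Acheck A (`|z|^-1 *: z)|%:E <= (u^-1)%:E)%E.
  apply: le_trans nA; apply: ereal_sup_ubound.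
  exists (`|z|^-1 *: z) => //=.
  by rewrite normrZ ger0_norm ?invr_ge0// mulVf// gt_eqF.
have -> : Acheck A (`|z|^-1 *: z) = `|z|^-1 *: Acheck A z.
  by rewrite /Acheck /= linearZ/= scalerBr.
rewrite lee_fin normrZ ger0_norm ?invr_ge0// ler_pdivrMl//.
by rewrite mulrC ler_pdivlMl.
Qed.

(** Adding the firm nonexpansiveness inequalities of the two proximity
    operators and expanding the square of the multiplier update, all terms
    cancel except squares of the right sign, once [Acheck_bound] is applied to
    the difference of the two displacements in the first two components. *)
Lemma TLAL_nonexpansive (z w : hprod (hprod X K) K) :
  `|TLAL A f g u z - TLAL A f g u w| <= `|z - w|.
Proof.
rewrite -(@ler_pXn2r _ 2)// ?nnegrE//.
case: z => -[x y] nu; case: w => -[x' y'] nu'; rewrite /TLAL !hprod_sqnorm/=.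
set vx := x - _ + _; set wx := x' - _ + _.
set vy := y - _ - _; set wy := y' - _ - _.
have := prox_firmly_nonexpansive vx wx Gf.
have := prox_firmly_nonexpansive vy wy Gg.
set p := prox f vx; set p' := prox f wx; set q := prox g vy; set q' := prox g wy.
set dp := p - p'; set dq := q - q'.
pose dx := x - x'; pose dy := y - y'; pose dn := nu - nu'.
pose M := A dx - dy; pose N := A dp - dq.
have adj (k : K) v : inner (adjoint A k) v = inner k (A v).
  by rewrite innerC -adjointP// innerC.
have -> : inner (vy - wy) dq = inner dy dq + u ^+ 2 * inner M dq - u * inner dn dq.
  rewrite /M /dx /dy /dn /vy /wy (linearB A) !innerE; ring.
have -> : inner (vx - wx) dp = inner dx dp - u ^+ 2 * inner M (A dp)
    + u * inner dn (A dp).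
  rewrite /M /dx /dy /dn /vx /wx /dp !(linearB A) !innerE !adj; ring.
have -> : (nu - u *: (A p - q)) - (nu' - u *: (A p' - q')) = dn - u *: N.
  rewrite /N /dn /dp /dq (linearB A).
  have -> : A p - A p' - (q - q') = (A p - q) - (A p' - q').
    by rewrite !opprD !opprK addrACA.
  by rewrite [in RHS]scalerBr !opprD !opprK addrACA.
have := Acheck_bound (dp - dx) (dq - dy).
have -> : A (dp - dx) - (dq - dy) = N - M.
  by rewrite /N /M (linearB A) !opprD !opprK addrACA.
rewrite -/dx -/dy -/dn (sqnormB dn) normrZ exprMn gtr0_norm// innerZr.
rewrite (sqnormB N) (sqnormB dp) (sqnormB dq).
have -> : inner N M = inner M (A dp) - inner M dq by rewrite innerC innerDr innerNr.
have -> : inner dn N = inner dn (A dp) - inner dn dq by rewrite innerDr innerNr.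
rewrite (innerC dp) (innerC dq).
have := mulr_ge0 (sqr_ge0 u) (sqr_ge0 `|M|).
lra.
Qed.

End LAL_operator.

(** * The auxiliary objective and its gradient *)

Section gradients.
Context {R : realType} {H : hilbertType R}.
Implicit Types (F : H -> R) (x y v : H).

Lemma is_derive_quotient F x v (d : R) : is_derive x v F d <->
  (fun h => h^-1 * (F (x + h *: v) - F x)) @ (0 : R)^' --> d.
Proof.
have E : (fun h => h^-1 * (F (x + h *: v) - F x)) =
    (fun h => h^-1 *: ((F \o shift x) (h *: v) - F x)).
  by apply/funext => h /=; rewrite (addrC x).
rewrite E; split => Fd.
  by rewrite -(@derive_val _ _ _ _ _ _ _ Fd); exact: ex_derive.
by apply: DeriveDef; [apply/cvg_ex; exists d|exact: cvg_lim].
Qed.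

Lemma is_gradient_unique F x g : is_gradient F x g -> gradient F x = g.
Proof.
move=> Fg; rewrite /gradient; case: xgetP => [h _ Fh|/(_ g)[]//].
apply: inner_ext => v; have := Fg v; have := Fh v => hv gv.
by rewrite -(@derive_val _ _ _ _ _ _ _ hv) (@derive_val _ _ _ _ _ _ _ gv).
Qed.

Lemma gradientP F x : gateaux_differentiable F -> is_gradient F x (gradient F x).
Proof. by move=> /(_ x)[g Fg]; rewrite (is_gradient_unique Fg). Qed.

(** By convexity the difference quotients of [F] from [x] towards [y] are at
    most [F y - F x]. *)
Lemma gradient_inequality F x y g : econvex (EFin \o F) -> is_gradient F x g ->
  F x + inner g (y - x) <= F y.
Proof.
move=> cF Fg; rewrite -lerBrDl leNgt; apply/negP => lt_.
have := (is_derive_quotient F x (y - x) _).1 (Fg (y - x)) => q.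
have [e /= e0 eP] := cvgr_gt _ q _ lt_.
pose h := Num.min e 1 / 2.
have h0 : 0 < h by rewrite divr_gt0// lt_min e0 ltr01.
have h1 : h < 1.
  have : Num.min e 1 <= 1 by rewrite ge_min lexx orbT.
  rewrite /h; lra.
have he : h < e.
  have : Num.min e 1 <= e by rewrite ge_min lexx.
  rewrite /h; lra.
have := eP h; rewrite /= sub0r normrN gtr0_norm// => /(_ he (lt0r_neq0 h0)).
rewrite ltNge => /negP; apply; rewrite ler_pdivrMl//.
have := cF y x h h0 h1; rewrite /= segmentE -!EFinM -EFinD lee_fin; lra.
Qed.

End gradients.

Section LAL_objective.
Context {R : realType} {X K : hilbertType R} (A : {linear X -> K})
  (Psi : X -> R) (etaxy etanu : R).
Context (bA : bounded_near A (nbhs (0 : X))) (cPsi : econvex (EFin \o Psi))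
  (dPsi : gateaux_differentiable Psi) (lPsi : lipschitz (gradient Psi))
  (mPsi : strongly_monotone (gradient Psi))
  (etaxy0 : 0 < etaxy) (etanu0 : 0 < etanu).
Local Notation Z := (hprod (hprod X K) K).
Implicit Types z w : Z.

Definition LAL_gradient z : Z :=
  let r := A z.1.1 - z.1.2 in
  (gradient Psi z.1.1 + etaxy *: adjoint A r, - (etaxy *: r), etanu *: z.2).

Let Theta := Theta_LAL A Psi etaxy etanu.

Let ThetaE z : Theta z = Psi z.1.1 + etaxy / 2 * `|A z.1.1 - z.1.2| ^+ 2 +
  etanu / 2 * `|z.2| ^+ 2.
Proof. by case: z => -[]. Qed.

Lemma Theta_convex : econvex (EFin \o Theta).
Proof.
move=> z w t t0 t1; rewrite /= -!EFinM -EFinD lee_fin !ThetaE /=.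
have := cPsi z.1.1 w.1.1 t0 t1; rewrite /= -!EFinM -EFinD lee_fin => h1.
have := @sqnorm_convex _ _ t z.2 w.2 (ltW t0) (ltW t1).
have := @sqnorm_convex _ _ t (A z.1.1 - z.1.2) (A w.1.1 - w.1.2) (ltW t0) (ltW t1).
have -> : t *: (A z.1.1 - z.1.2) + (1 - t) *: (A w.1.1 - w.1.2) =
    A (t *: z.1.1 + (1 - t) *: w.1.1) - (t *: z.1.2 + (1 - t) *: w.1.2).
  by rewrite (linearD A) !linearZ/= !scalerBr addrACA opprD.
have e1 : 0 <= etaxy / 2 by rewrite divr_ge0// ltW.
have e2 : 0 <= etanu / 2 by rewrite divr_ge0// ltW.
move=> /(ler_wpM2l e1) h2 /(ler_wpM2l e2) h3.
move: h1 h2 h3; lra.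
Qed.

Lemma Theta_gradient z : is_gradient Theta z (LAL_gradient z).
Proof.
move=> v; apply/is_derive_quotient.
set r := A z.1.1 - z.1.2; pose s := A v.1.1 - v.1.2.
have -> : inner (LAL_gradient z) v = inner (gradient Psi z.1.1) v.1.1 +
    (etaxy * inner r s + etanu * inner z.2 v.2 +
     0 * (etaxy / 2 * `|s| ^+ 2 + etanu / 2 * `|v.2| ^+ 2)).
  rewrite !hprod_innerE/= -/r innerDl innerNl !innerZl (innerC (adjoint A r)).
  by rewrite -adjointP// (innerC _ r) /s innerDr innerNr; ring.
have Psiq := (is_derive_quotient Psi z.1.1 v.1.1 _).1 (gradientP z.1.1 dPsi v.1.1).
have : (fun h : R => h^-1 * (Psi (z.1.1 + h *: v.1.1) - Psi z.1.1) +
    (etaxy * inner r s + etanu * inner z.2 v.2 +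
     h * (etaxy / 2 * `|s| ^+ 2 + etanu / 2 * `|v.2| ^+ 2))) @ 0^' -->
    inner (gradient Psi z.1.1) v.1.1 + (etaxy * inner r s + etanu * inner z.2 v.2 +
     0 * (etaxy / 2 * `|s| ^+ 2 + etanu / 2 * `|v.2| ^+ 2)).
  apply: cvgD => //; apply: cvgD; first exact: cvg_cst.
  apply: cvgM; last exact: cvg_cst.
  by apply: cvg_within_filter; exact: cvg_id.
apply: cvg_trans; apply: near_eq_cvg.
near=> h.
have h0 : h != 0 by near: h; exact: nbhs_dnbhs_neq.
rewrite !ThetaE /=.
have -> : A (z.1.1 + h *: v.1.1) - (z.1.2 + h *: v.1.2) = r + h *: s.
  by rewrite (linearD A) linearZ/= /r /s scalerBr opprD addrACA.
rewrite -/r (sqnormD r) (sqnormD z.2) !innerZr !normrZ !exprMn.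
rewrite !real_normK ?num_real//.
by field.
Unshelve. all: by end_near. Qed.

Lemma gradient_LALE z : gradient Theta z = LAL_gradient z.
Proof. exact/is_gradient_unique/Theta_gradient. Qed.

Lemma LAL_gradient_ineq z w :
  Theta z + inner (LAL_gradient z) (w - z) <= Theta w.
Proof. exact: gradient_inequality Theta_convex (Theta_gradient z). Qed.

Lemma adjoint_bound (b : R) (k : K) : (forall x, `|A x| <= b * `|x|) -> 0 <= b ->
  `|adjoint A k| <= b * `|k|.
Proof.
move=> Ab b0; have [->|k0] := eqVneq (adjoint A k) 0.
  by rewrite normr0 mulr_ge0.
have nk : 0 < `|adjoint A k| by rewrite normr_gt0.
rewrite -(ler_pM2l nk) -expr2 -inner_norm -adjointP//.
apply: (le_trans (cauchy_schwarz _ _)).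
by rewrite mulrA [_ * b]mulrC ler_wpM2r.
Qed.

Lemma adjointB k l : adjoint A (k - l) = adjoint A k - adjoint A l.
Proof.
by apply: inner_ext => v; rewrite innerC -adjointP// !innerE !(innerC _ v)
  -!adjointP.
Qed.

Lemma LAL_gradientB z w (r := A (z.1.1 - w.1.1) - (z.1.2 - w.1.2)) :
  LAL_gradient z - LAL_gradient w =
  (gradient Psi z.1.1 - gradient Psi w.1.1 + etaxy *: adjoint A r,
   - (etaxy *: r), etanu *: (z.2 - w.2)).
Proof.
have -> : r = (A z.1.1 - z.1.2) - (A w.1.1 - w.1.2).
  by rewrite /r (linearB A) !opprD !opprK addrACA.
rewrite adjointB !scalerBr; congr (_, _, _) => /=.
  by rewrite !opprD addrACA.
by rewrite !scalerBr !opprD !opprK.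
Qed.

Lemma LAL_gradient_lipschitz : exists2 kappa, 0 < kappa &
  forall z w, `|LAL_gradient z - LAL_gradient w| <= kappa * `|z - w|.
Proof.
have [b b0 bAx] := bounded_linearP bA.
have [L L0 LP] := pinfty_ex_gt0 lPsi.
exists (L + etaxy * (b * (b + 1)) + etaxy * (b + 1) + etanu).
  by rewrite !addr_gt0// !mulr_gt0// addr_gt0.
move=> z w; rewrite LAL_gradientB; set r := A _ - _.
have norm_le (Y Y' : hilbertType R) (p : hprod Y Y') : `|p| <= `|p.1| + `|p.2|.
  rewrite -(@ler_pXn2r _ 2)// ?nnegrE ?addr_ge0// hprod_sqnorm sqrrD.
  by have := mulr_ge0 (normr_ge0 p.1) (normr_ge0 p.2); lra.
have zw1 : `|z.1 - w.1| <= `|z - w| by exact: (hprod_norm_fst (z - w)).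
have zw2 : `|z.2 - w.2| <= `|z - w| by exact: (hprod_norm_snd (z - w)).
have zw11 : `|z.1.1 - w.1.1| <= `|z - w|.
  by apply: le_trans zw1; exact: (hprod_norm_fst (z.1 - w.1)).
have zw12 : `|z.1.2 - w.1.2| <= `|z - w|.
  by apply: le_trans zw1; exact: (hprod_norm_snd (z.1 - w.1)).
have rb : `|r| <= (b + 1) * `|z - w|.
  rewrite mulrDl mul1r; apply: (le_trans (ler_normB _ _)); apply: lerD => //.
  by apply: (le_trans (bAx _)); rewrite ler_pM2l.
have h1 : `|gradient Psi z.1.1 - gradient Psi w.1.1| <= L * `|z - w|.
  by apply: (le_trans (LP (z.1.1, w.1.1) _)) => //; rewrite ler_pM2l.
have h2 : `|adjoint A r| <= b * ((b + 1) * `|z - w|).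
  apply: (le_trans (adjoint_bound _ bAx (ltW b0))).
  by rewrite ler_pM2l.
apply: (le_trans (norm_le _ _ _)) => /=.
apply: (le_trans (lerD (norm_le _ _ _) (lexx _))) => /=.
apply: (le_trans (lerD (lerD (ler_normD _ _) (lexx _)) (lexx _))).
rewrite normrN !normrZ (gtr0_norm etaxy0) (gtr0_norm etanu0).
have := ler_wpM2l (ltW etaxy0) h2; have := ler_wpM2l (ltW etaxy0) rb.
have := ler_wpM2l (ltW etanu0) zw2; move: h1; lra.
Qed.

(** Strong monotonicity in the [y] component comes from the penalty term,
    since [y] is recovered from [x] and the residual [A x - y]. *)
Lemma LAL_gradient_monotone : exists2 eta, 0 < eta & forall z w,
  eta * `|z - w| ^+ 2 <= inner (LAL_gradient z - LAL_gradient w) (z - w).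
Proof.
have [b b0 bAx] := bounded_linearP bA.
have [e e0 eP] := mPsi.
have c0 : 0 < 1 + 2 * b ^+ 2 by rewrite ltr_pwDl// mulr_ge0// sqr_ge0.
pose rho := Num.min (e / (1 + 2 * b ^+ 2)) (Num.min (etaxy / 2) etanu).
have rho0 : 0 < rho by rewrite !lt_min !divr_gt0.
have rho1 : rho * (1 + 2 * b ^+ 2) <= e by rewrite -ler_pdivlMr// ge_min lexx.
have rho2 : 2 * rho <= etaxy.
  have : rho <= etaxy / 2 by rewrite !ge_min lexx orbT.
  lra.
have rho3 : rho <= etanu by rewrite !ge_min lexx !orbT.
exists rho => // z w; rewrite LAL_gradientB; set r := A _ - _.
rewrite !hprod_innerE hprod_sqnorm hprod_sqnorm /=.
set dx := z.1.1 - w.1.1 in r *; set dy := z.1.2 - w.1.2 in r *.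
rewrite innerDl innerNl !innerZl inner_norm (innerC (adjoint A r)) -adjointP//.
have -> : inner (A dx) r = `|r| ^+ 2 + inner r dy.
  by rewrite -inner_norm -innerDr (innerC r) subrK.
have dyb : `|dy| ^+ 2 <= 2 * `|r| ^+ 2 + 2 * b ^+ 2 * `|dx| ^+ 2.
  have h : `|dy| <= `|r| + b * `|dx|.
    have -> : dy = A dx - r by rewrite /r opprB addrC subrK.
    by rewrite [leRHS]addrC; apply: (le_trans (ler_normB _ _)); rewrite lerD.
  have : `|dy| ^+ 2 <= (`|r| + b * `|dx|) ^+ 2.
    by rewrite ler_pXn2r ?nnegrE// addr_ge0// mulr_ge0// ltW.
  have := sqr_ge0 (`|r| - b * `|dx|); lra.
have := eP z.1.1 w.1.1; rewrite -/dx.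
have := ler_wpM2l (ltW rho0) dyb.
have := ler_wpM2r (sqr_ge0 `|dx|) rho1.
have := ler_wpM2r (sqr_ge0 `|r|) rho2.
have := ler_wpM2r (sqr_ge0 `|z.2 - w.2|) rho3.
lra.
Qed.

End LAL_objective.

(** * The hierarchical problem *)

Section LAL_solution.
Context {R : realType} {X K : hilbertType R} (f : X -> \bar R)
  (g : K -> \bar R) (A : {linear X -> K}) (u : R) (Psi : X -> R).
Context (Gf : Gamma0 f) (Gg : Gamma0 g) (bA : bounded_near A (nbhs (0 : X)))
  (u0 : 0 < u) (nA : (opnorm (Acheck A) <= (u^-1)%:E)%E)
  (sA : sri [set y - A x | y in dom g & x in dom f] 0)
  (cPsi : econvex (EFin \o Psi)) (dPsi : gateaux_differentiable Psi)
  (lPsi : lipschitz (gradient Psi)) (mPsi : strongly_monotone (gradient Psi)).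
Let Sp := argmin (fun x => (f x + g (A x))%E) [set: X].
Context (Sp0 : Sp !=set0).
Local Notation Z := (hprod (hprod X K) K).

Definition relaxed_TLAL (alpha : R) (z : Z) : Z :=
  (1 - alpha) *: z + alpha *: TLAL A f g u z.

Lemma relaxed_TLAL_nonexpansive alpha z w : 0 < alpha -> alpha <= 1 ->
  `|relaxed_TLAL alpha z - relaxed_TLAL alpha w| <= `|z - w|.
Proof.
move=> a0 a1.
have -> : relaxed_TLAL alpha z - relaxed_TLAL alpha w =
    (1 - alpha) *: (z - w) + alpha *: (TLAL A f g u z - TLAL A f g u w).
  by rewrite /relaxed_TLAL !scalerBr opprD addrACA.
apply: (le_trans (ler_normD _ _)); rewrite !normrZ (gtr0_norm a0).
have a1' : 0 <= 1 - alpha by rewrite subr_ge0.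
rewrite (ger0_norm a1').
have := ler_wpM2l (ltW a0) (TLAL_nonexpansive Gf Gg bA u0 nA z w); lra.
Qed.

Lemma relaxed_TLAL_fixed alpha z : 0 < alpha ->
  relaxed_TLAL alpha z = z <-> TLAL A f g u z = z.
Proof.
move=> a0; have E : relaxed_TLAL alpha z - z = alpha *: (TLAL A f g u z - z).
  by rewrite /relaxed_TLAL scalerBl scale1r scalerBr addrAC (addrAC z) subrr
    sub0r addrC.
split => /eqP; rewrite -subr_eq0.
  by rewrite E scaler_eq0 gt_eqF//= subr_eq0 => /eqP.
by move=> /eqP h; apply/eqP; rewrite -subr_eq0 E h scaler0.
Qed.

(** The saddle inequality involves a primal solution only through the optimal
    value, which all primal solutions share. *)
Lemma fixed_of_Sp x0 y0 nu0 x : TLAL A f g u (x0, y0, nu0) = (x0, y0, nu0) ->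
  Sp x -> TLAL A f g u (x, A x, nu0) = (x, A x, nu0).
Proof.
move=> fixed Spx.
have [y0E [_ min0] [r0 [s0 [fx0 gy0 sad]]]] := TLAL_fixed Gf Gg bA u0 fixed.
have dom0 : (dom g `&` A @` dom f) !=set0.
  exists y0; split; first by rewrite /dom/= gy0 ltry.
  by exists x0; rewrite // /dom/= fx0 ltry.
have [r [s [fx gAx]]] := Sp_fin Gf Gg dom0 Spx.
apply: (fixed_TLAL bA fx gAx).
suff -> : r + s = r0 + s0 by [].
apply/eqP; rewrite eq_le -!lee_fin !EFinD -fx -gAx -fx0 -gy0 y0E.
by rewrite (Spx.2 x0 Logic.I) (min0 x Logic.I).
Qed.

Lemma TLAL_fixed_exists : exists z, TLAL A f g u z = z.
Proof.
have [x Spx] := Sp0.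
have dom0 : (dom g `&` A @` dom f) !=set0.
  have [[y gy [x' fx' yx]] _] := sA; exists y; split => //; exists x' => //.
  by apply/esym/eqP; rewrite -subr_eq0 yx.
have [r [s [fx gAx]]] := Sp_fin Gf Gg dom0 Spx.
have [nu sad] := saddle_exists Gf Gg bA u0 sA Spx fx gAx.
by exists (x, A x, nu); exact: (fixed_TLAL bA fx gAx sad).
Qed.

(** The minimizer of the auxiliary objective over the fixed points
    has the unique solution of the hierarchical problem as its first
    component, because the penalty vanishes on fixed points and the
    multiplier component does not depend on the primal solution. *)
Lemma LAL_solution (alpha etaxy etanu : R) : 0 < alpha -> alpha <= 1 ->
  0 < etaxy -> 0 < etanu ->
  exists z0 : Z, argmin (EFin \o Psi) Sp = [set z0.1.1] /\
  forall (lam : nat -> R) (z : nat -> Z), stepsW lam \/ stepsL lam ->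
    (forall n, z n.+1 = relaxed_TLAL alpha (z n) -
      lam n.+1 *: LAL_gradient A Psi etaxy etanu (relaxed_TLAL alpha (z n))) ->
    z @ \oo --> z0.
Proof.
move=> a0 a1 exy0 enu0.
have [kappa kappa0 Glip] := LAL_gradient_lipschitz bA lPsi exy0 enu0.
have [eta eta0 Gmon] := LAL_gradient_monotone bA mPsi exy0 enu0.
have Tne z w := @relaxed_TLAL_nonexpansive alpha z w a0 a1.
have Tineq := LAL_gradient_ineq bA cPsi dPsi exy0 enu0.
have [p Tp] := TLAL_fixed_exists.
have [z0 [Tz0 z0min approx]] := steepest_descent_path kappa0 eta0 Tne Glip Gmon
  Tineq ((relaxed_TLAL_fixed p a0).2 Tp).
exists z0; split; last first.
  move=> lam z steps zE.
  exact: (@hybrid_steepest_descent_cvg _ _ _ _ kappa eta kappa0 eta0 Tne Glip Gmon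
    lam z z0 Tz0 approx steps zE).
move: Tz0 z0min => /(relaxed_TLAL_fixed _ a0).1; clear approx.
case: z0 => -[x0 y0] nu0 Tz0 z0min /=.
have [y0E Spx0 _] := TLAL_fixed Gf Gg bA u0 Tz0.
have strict x : Sp x -> Psi x0 + eta / 4 * `|x - x0| ^+ 2 <= Psi x.
  move=> Spx.
  have := z0min (x, A x, nu0) ((relaxed_TLAL_fixed _ a0).2 (fixed_of_Sp Tz0 Spx)).
  rewrite /Theta_LAL y0E !subrr normr0 expr0n/= mulr0 !addr0.
  have : eta / 4 * `|x - x0| ^+ 2 <=
      eta / 4 * `|((x, A x, nu0) : Z) - (x0, A x0, nu0)| ^+ 2.
    apply: ler_wpM2l; first by rewrite divr_ge0// ltW.
    by rewrite !hprod_sqnorm /= -addrA lerDl addr_ge0// sqr_ge0.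
  by lra.
apply/seteqP; split => [x [Spx xmin]|x ->] /=; last first.
  split => // x' /strict; rewrite lee_fin; apply: le_trans.
  by rewrite lerDl mulr_ge0 ?sqr_ge0// divr_ge0// ltW.
have := strict _ Spx; have := xmin _ Spx0; rewrite /= lee_fin => h1 h2.
apply/eqP; rewrite -subr_eq0 -normr_eq0 -sqrf_eq0 eq_le sqr_ge0 andbT.
have eta4 : 0 < eta / 4 by rewrite divr_gt0.
by rewrite -(pmulr_rle0 _ eta4); lra.
Qed.

End LAL_solution.

Theorem theorem19 (R : realType) (X K : hilbertType R)
    (f : X -> \bar R) (g : K -> \bar R) (A : {linear X -> K}) (u : R)
    (Psi : X -> R) :
  let Sp := argmin (fun x => (f x + g (A x))%E) [set: X] in
  Gamma0 f -> Gamma0 g -> bounded_near A (nbhs (0 : X)) ->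
  Sp !=set0 ->
  sri [set y - A x | y in dom g & x in dom f] 0 ->
  0 < u -> (opnorm (Acheck A) <= (u^-1)%:E)%E ->
  Gamma0 (EFin \o Psi) -> gateaux_differentiable Psi ->
  lipschitz (gradient Psi) -> strongly_monotone (gradient Psi) ->
  exists2 xs : X, argmin (EFin \o Psi) Sp = [set xs] &
  forall alpha etaxy etanu : R, 0 < alpha -> alpha <= 1 ->
    0 < etaxy -> 0 < etanu ->
  forall (lam : nat -> R) (x xh : nat -> X) (y yh nu nuh : nat -> K),
  (forall n,
    ((xh n, yh n, nuh n) : hprod (hprod X K) K) =
      (1 - alpha) *: ((x n, y n, nu n) : hprod (hprod X K) K)
      + alpha *: TLAL A f g u (x n, y n, nu n)) ->
  (forall n, x n.+1 = xh n - lam n.+1 *: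
    (gradient Psi (xh n) + etaxy *: adjoint A (A (xh n) - yh n))) ->
  (forall n, y n.+1 = yh n + (lam n.+1 * etaxy) *: (A (xh n) - yh n)) ->
  (forall n, nu n.+1 = nuh n - (lam n.+1 * etanu) *: nuh n) ->
  hybrid_steepest_descent
    (fun z : hprod (hprod X K) K => (1 - alpha) *: z + alpha *: TLAL A f g u z)
    (Theta_LAL A Psi etaxy etanu) lam
    (fun n => (x n, y n, nu n)) /\
  (stepsW lam \/ stepsL lam -> x @ \oo --> xs).
Proof.
move=> Sp Gf Gg bA Sp0 sA u0 nA GPsi dPsi lPsi mPsi.
have [_ _ cPsi] := GPsi.
have [z1 [argminE _]] := @LAL_solution R X K f g A u Psi Gf Gg bA u0 nA sA cPsi
  dPsi lPsi mPsi Sp0 1 1 1 ltr01 (lexx _) ltr01 ltr01.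
exists z1.1.1 => // alpha etaxy etanu a0 a1 exy0 enu0 lam x xh y yh nu nuh.
move=> zhE xE yE nuE.
have [z0 [argminE0 cvg0]] := @LAL_solution R X K f g A u Psi Gf Gg bA u0 nA sA
  cPsi dPsi lPsi mPsi Sp0 alpha etaxy etanu a0 a1 exy0 enu0.
pose z n : hprod (hprod X K) K := (x n, y n, nu n).
have zS n : z n.+1 = relaxed_TLAL f g A u alpha (z n) -
    lam n.+1 *: LAL_gradient A Psi etaxy etanu (relaxed_TLAL f g A u alpha (z n)).
  rewrite /relaxed_TLAL -zhE /z xE yE nuE /LAL_gradient /=.
  congr (_, _, _) => /=.
    by rewrite scalerN opprK scalerA.
  by rewrite scalerA.
split.
  split.
  - by move=> [v w] _ /=; rewrite mul1r; exact: relaxed_TLAL_nonexpansive.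
  - exact: Theta_convex.
  - by move=> v; exists (LAL_gradient A Psi etaxy etanu v); exact: Theta_gradient.
  - by move=> n; rewrite gradient_LALE//; exact: zS.
move=> steps; have zz0 := cvg0 lam z steps zS.
have -> : z1.1.1 = z0.1.1.
  have : [set z1.1.1] z0.1.1 by rewrite -argminE argminE0.
  by move=> /= ->.
apply: (@cvgn_dist_le _ _ _ _ (fun n => `|z n - z0|)); last exact: cvgn_dist.
move=> n; apply: le_trans (hprod_norm_fst (z n - z0)).
exact: (hprod_norm_fst (z n - z0).1).
Qed.
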